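(* Let $d\ge 1$ and let $(X_n)_{n\in\mathbb Z}$, $X_n=(X_n^{(1)},\dots,X_n^{(d)})$, be a strictly stationary process of $\mathbb R^d$-valued random vectors; let $F^{(k)}$ be the distribution function of $X_1^{(k)}$ ($k=1,\dots,d$). Let $\pi:(]0,1[^d)^{\mathbb Z}\to(\mathbb R^d)^{\mathbb Z}$ be the map which applies $F^{-1}=((F^{(1)})^{-1},\dots,(F^{(d)})^{-1})$ in every coordinate $n\in\mathbb Z$. Then there exists a strictly stationary $]0,1[^d$-valued process $(U_m)_{m\in\mathbb Z}$, $U_m=(U_m^{(1)},\dots,U_m^{(d)})$, such that $(X_n)_{n\in\mathbb Z}$ is a factor of $(U_m)_{m\in\mathbb Z}$ via $\pi$, i.e. $\pi$ transports the law $\mu$ of $(U_m)_{m\in\mathbb Z}$ on $(]0,1[^d)^{\mathbb Z}$ to the law $\nu$ of $(X_n)_{n\in\mathbb Z}$ on $(\mathbb R^d)^{\mathbb Z}$ ($\pi\mu=\nu$), and such that the one-dimensional marginals $U_m^{(k)}$ ($m\in\mathbb Z$, $k=1,\dots,d$) are uniformly distributed on $]0,1[$. Moreover, if the process $(X_n)_{n\in\mathbb Z}$ is ergodic, weakly mixing, mixing, strongly mixing with rate $\alpha(n)$, absolutely regular with rate $\beta(n)$, or uniformly mixing with rate $\varphi(n)$, then the process $(U_m)_{m\in\mathbb Z}$ can be constructed with the same properties, including the rates.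
   Context: For a distribution function $G$ on $\mathbb R$, $G^{-1}(s)=\inf\{t: G(t)\ge s\}$ for $0<s<1$. Inequality-free conventions: $]0,1[$ is the open unit interval. Let $E$ be $\mathbb R^d$ or $]0,1[^d$ and let $\rho$ be the law on $E^{\mathbb Z}$ of a strictly stationary $E$-valued process indexed by $\mathbb Z$; let $p_t$ ($t\in\mathbb Z$) be the coordinate projections $p_t((x(n))_{n\in\mathbb Z})=x(t)$, and let $\sigma(\cdot)$ denote the generated $\sigma$-field. The process (equivalently $\rho$) is called ergodic, weakly mixing or mixing if the shift on $(E^{\mathbb Z},\rho)$ has this property. It is called: (a) uniformly mixing with rate $\varphi(n)$ if $\varphi(n)=\sup\{|\rho(B|A)-\rho(B)|: A\in\sigma(p_t:t\le 0),\ \rho(A)>0,\ B\in\sigma(p_t:t\ge n)\}\to 0$ as $n\to\infty$; (b) absolutely regular with rate $\beta(n)$ if $\beta(n)=E_\rho\left[\sup\{|\rho(B|\sigma(p_t:t\le 0))-\rho(B)|: B\in\sigma(p_t:t\ge n)\}\right]\to 0$ as $n\to\infty$ (with a regular version of the conditional probability, $E_\rho$ denoting expectation); (c) strongly mixing with rate $\alpha(n)$ if $\alpha(n)=\sup\{|\rho(A\cap B)-\rho(A)\rho(B)|: A\in\sigma(p_t:t\le 0),\ B\in\sigma(p_t:t\ge n)\}\to 0$ as $n\to\infty$. *)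

(* Defs.v *)
From HB Require Import structures.
From mathcomp Require Import all_boot all_order all_algebra.
From mathcomp Require Import all_classical all_reals all_analysis.
From mathcomp Require Import measurable_realfun.

Set Implicit Arguments.
Unset Strict Implicit.
Unset Printing Implicit Defensive.

Import Order.TTheory GRing.Theory Num.Theory.
Import numFieldNormedType.Exports.

Local Open Scope classical_set_scope.
Local Open Scope ring_scope.

(* The open unit interval ]0,1[, with the trace of the Borel sigma-algebra. *)
Definition oitv01 (R : realType) : Type := {x : R | 0 < x < 1}.

Section oitv01_instances.
Variable R : realType.

HB.instance Definition _ := Choice.copy (oitv01 R) {x : R | 0 < x < 1}.

Fact half_in_oitv01 : 0 < (2^-1 : R) < 1.
Proof. by rewrite invr_gt0 ltr0n invf_lt1 ?ltr1n ?ltr0n. Qed.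

HB.instance Definition _ := isPointed.Build (oitv01 R)
  (exist (fun x : R => 0 < x < 1) 2^-1 half_in_oitv01).

Definition oitv01_val (x : oitv01 R) : R := \val x.

HB.instance Definition _ := Measurable.copy (oitv01 R)
  (g_sigma_algebra_preimageType oitv01_val).

End oitv01_instances.

Definition zseq (E : Type) : Type := int -> E.

(* sigma(p_t : t \in I) *)
Definition coord_sigma d (E : measurableType d) (I : set int) :
    set (set (zseq E)) :=
  <<s \bigcup_(t in I)
        preimage_set_system setT (fun x : zseq E => x t) measurable >>.

Definition zseq_display : measure_display -> measure_display.
Proof. exact. Qed.

Section zseq_measurable.
Context d (E : measurableType d).

HB.instance Definition _ := Pointed.copy (zseq E) (int -> E).

Let zseq_set0 : @coord_sigma d E setT set0.
Proof. exact: sigma_algebra0. Qed.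

Let zseq_setC A : @coord_sigma d E setT A -> @coord_sigma d E setT (~` A).
Proof. exact: sigma_algebraC. Qed.

Let zseq_bigcup (F : _^nat) : (forall i, @coord_sigma d E setT (F i)) ->
  @coord_sigma d E setT (\bigcup_i (F i)).
Proof. exact: sigma_algebra_bigcup. Qed.

HB.instance Definition _ := @isMeasurable.Build (zseq_display d)
  (zseq E) (@coord_sigma d E setT) zseq_set0 zseq_setC zseq_bigcup.

End zseq_measurable.

Definition trajectory dO (Omega : measurableType dO) dE (E : measurableType dE)
    (X : int -> {mfun Omega >-> E}) : Omega -> zseq E :=
  fun w n => X n w.

Section trajectory_measurable.
Context dO (Omega : measurableType dO) dE (E : measurableType dE).
Variable X : int -> {mfun Omega >-> E}.

Let measurable_trajectory : measurable_fun setT (trajectory X).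
Proof.
apply: (@measurability _ _ _ _ _ _ (\bigcup_(t in [set: int])
  preimage_set_system setT (fun x : zseq E => x t) measurable)) => //.
move=> _ [_ [t _ [B mB <-]] <-].
rewrite !setTI -[X in measurable X]setTI.
exact: (@measurable_funPT _ _ _ _ (X t)).
Qed.

HB.instance Definition _ :=
  isMeasurableFun.Build _ _ _ _ (trajectory X) measurable_trajectory.

End trajectory_measurable.

Definition process_law dO (Omega : measurableType dO) (R : realType)
    (P : probability Omega R) dE (E : measurableType dE)
    (X : int -> {RV P >-> E}) : probability (zseq E) R :=
  distribution P (trajectory X).

Definition strictly_stationary dO (Omega : measurableType dO) (R : realType)
    (P : probability Omega R) dE (E : measurableType dE)
    (X : int -> {RV P >-> E}) : Prop :=
  forall (h : int) (A : set (zseq E)), measurable A ->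
    process_law (fun n => X (n + h)) A = process_law X A.

(* X_n^(k), with k ranging over {0,...,d-1} instead of {1,...,d}. *)
Definition marginal dO (Omega : measurableType dO) dE (E : measurableType dE)
    (d : nat) (X : int -> {mfun Omega >-> d.-tuple E}) (n : int) (k : 'I_d) :
    Omega -> E :=
  fun w => tnth (X n w) k.

Section marginal_measurable.
Context dO (Omega : measurableType dO) dE (E : measurableType dE).
Variables (d : nat) (X : int -> {mfun Omega >-> d.-tuple E}).
Variables (n : int) (k : 'I_d).

Let measurable_marginal : measurable_fun setT (marginal X n k).
Proof.
exact: (measurableT_comp (measurable_tnth k) (@measurable_funPT _ _ _ _ (X n))).
Qed.

HB.instance Definition _ :=
  isMeasurableFun.Build _ _ _ _ (marginal X n k) measurable_marginal.

End marginal_measurable.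

Definition quantile (R : realType) (G : R -> \bar R) (s : R) : R :=
  inf [set t | (s%:E <= G t)%E].

Definition coord_quantile (R : realType) (d : nat) (F : 'I_d -> R -> \bar R)
    (u : zseq (d.-tuple (oitv01 R))) : zseq (d.-tuple R) :=
  fun n => [tuple quantile (F k) (oitv01_val (tnth (u n) k)) | k < d].

Definition factor_via (R : realType) d1 (T1 : measurableType d1)
    d2 (T2 : measurableType d2) (f : T1 -> T2)
    (mu : probability T1 R) (nu : probability T2 R) : Prop :=
  measurable_fun setT f /\
  forall A, measurable A -> pushforward mu f A = nu A.

Definition seq_shift (E : Type) (x : zseq E) : zseq E := fun n => x (n + 1).

Section mixing_properties.
Context (R : realType) dE (E : measurableType dE).
Variable rho : probability (zseq E) R.
Local Open Scope ereal_scope.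

Definition ergodic : Prop :=
  forall A : set (zseq E), measurable A -> @seq_shift E @^-1` A = A ->
    rho A = 0 \/ rho A = 1.

Definition weakly_mixing : Prop :=
  forall A B : set (zseq E), measurable A -> measurable B ->
    (n%:R^-1)%:E * \sum_(i < n)
      `|rho (A `&` iter i (@seq_shift E) @^-1` B) - rho A * rho B|
      @[n --> \oo] --> 0.

Definition mixing : Prop :=
  forall A B : set (zseq E), measurable A -> measurable B ->
    rho (A `&` iter n (@seq_shift E) @^-1` B) @[n --> \oo] --> rho A * rho B.

Definition past : set (set (zseq E)) := @coord_sigma _ E [set t | t <= 0]%R.

Definition future (n : nat) : set (set (zseq E)) :=
  @coord_sigma _ E [set t | n%:Z <= t]%R.

Definition alpha_coef (n : nat) : \bar R :=
  ereal_sup [set `|rho (A `&` B) - rho A * rho B| | A in past & B in future n].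

Definition phi_coef (n : nat) : \bar R :=
  ereal_sup [set `|rho (A `&` B) / rho A - rho B|
            | A in [set A | past A /\ 0 < rho A] & B in future n].

(* kappa x B is a regular version of rho(B | sigma(p_t : t <= 0))(x).  When E
   is a standard Borel space such a kappa exists and is unique up to a rho-null
   set of x, so that beta_coef below does not depend on its choice. *)
Definition regular_cond_past (kappa : zseq E -> probability (zseq E) R) : Prop :=
  (forall (B : set (zseq E)) (Y : set (\bar R)), measurable B ->
     measurable Y -> past ((fun x => kappa x B) @^-1` Y)) /\
  (forall A B : set (zseq E), past A -> measurable B ->
     \int[rho]_(x in A) kappa x B = rho (A `&` B)).

Definition beta_coef (kappa : zseq E -> probability (zseq E) R) (n : nat) :
    \bar R :=
  \int[rho]_x ereal_sup [set `|kappa x B - rho B| | B in future n].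

(* Rates are indexed by n >= 1: at n = 0 past and future share the coordinate
   p_0, and the coefficients at n = 0 do not measure any mixing. *)
Definition strongly_mixing_rate (a : nat -> R) : Prop :=
  (forall n, (0 < n)%N -> alpha_coef n = (a n)%:E) /\
  a n @[n --> \oo] --> (0 : R)%R.

Definition absolutely_regular_rate (b : nat -> R) : Prop :=
  (exists2 kappa, regular_cond_past kappa &
     forall n, (0 < n)%N -> beta_coef kappa n = (b n)%:E) /\
  b n @[n --> \oo] --> (0 : R)%R.

Definition uniformly_mixing_rate (f : nat -> R) : Prop :=
  (forall n, (0 < n)%N -> phi_coef n = (f n)%:E) /\
  f n @[n --> \oo] --> (0 : R)%R.

End mixing_properties.

(* Main.v *)
From HB Require Import structures.
Require Import Defs.
From mathcomp Require Import all_boot all_order all_algebra.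
From mathcomp Require Import all_classical all_reals all_analysis.
From mathcomp Require Import measurable_realfun.
From mathcomp Require Import ring lra zify.

Set Implicit Arguments.
Unset Strict Implicit.
Unset Printing Implicit Defensive.

Import Order.TTheory GRing.Theory Num.Theory.
Import numFieldNormedType.Exports.

Local Open Scope classical_set_scope.
Local Open Scope ring_scope.


(** Were all marginal distribution functions F continuous, U_n = F(X_n) would
    do. In general the jumps of F have to be filled: let (V_n) be independent
    uniform variables, independent of X, and let U_n^(k) be the point of the
    interval from F(x-) to F(x), at x = X_n^(k), that lies at the fraction V_n
    of that interval. This distributional transform is uniform
    ([unif_dist_transform]), and the quantile function maps it back to x almost
    surely ([quantile_unit_transform]); the first fact gives the marginals, and
    the second one gives the factor map. The noise is read off the binary digits
    of one uniform variable ([unif_split], [iid_unif_noise]).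

    The other properties hold for every process U_n = g(X_n, V_n) computed one
    time step at a time from a process X and an i.i.d. noise V, from which X can
    be decoded time by time ([code], [decode]). For a frozen noise z, an event A
    of the past (future) of U becomes an event A_z of the past (future) of X, and
    the sections of a past and of a future event involve independent parts of
    the noise. Hence P(A and B) - P(A) P(B) is the average over z of
    nu(A_z and B_z) - nu(A_z) nu(B_z), which bounds the rates alpha and phi of U
    by those of X; the converse bounds hold because X is decoded from U
    ([alpha_coef_code], [phi_coef_code]). For beta, a conditional law of the
    future of U given its past u is obtained by decoding u, drawing the future of
    X from its conditional law, and drawing fresh noise
    ([regular_code_kernel], [beta_coef_code]).

    For the shift-invariant properties it is enough to work in the product of X
    with the noise, of which U is a factor. The correlations of this product are
    negligible, in the sense of plain or of Cesaro convergence, on rectangles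
    over cylinders of the noise, since distant cylinders of the noise are
    independent; an approximation uniform in time carries this over to all events
    ([null_dynkin], [mixing_code], [weakly_mixing_code]). For ergodicity, the same
    approximation shows that an invariant event of the product is, given X,
    independent of itself, so that it is almost surely an event of X, and an
    invariant one ([invariant_event_ergodic]). *)

(** * Sigma-algebras on sequence spaces *)

Definition splice (E : Type) (I : set int) (x y : zseq E) : zseq E :=
  fun t => if `[< I t >] then x t else y t.

Definition shiftz (E : Type) (h : int) (x : zseq E) : zseq E :=
  fun t => x (t + h).

Lemma iter_seq_shift (E : Type) n (x : zseq E) :
  iter n (@seq_shift E) x = shiftz n%:Z x.
Proof.
elim: n => [|n IH]; apply/funext => t /=; first by rewrite /shiftz addr0.
by rewrite IH /seq_shift /shiftz intS addrA.
Qed.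

Section coordinates.
Context d (E : measurableType d).
Implicit Types (I J : set int) (x y : zseq E).

Lemma coord_sigma_algebra I : sigma_algebra setT (@coord_sigma d E I).
Proof. exact: smallest_sigma_algebra. Qed.

Lemma coord_sigma_eval I t (B : set E) : I t -> measurable B ->
  coord_sigma I ((fun x : zseq E => x t) @^-1` B).
Proof.
by move=> It mB; apply: sub_sigma_algebra; exists t => //; exists B; rewrite ?setTI.
Qed.

(** The sets with preimage in [S] form a sigma-algebra, so the generators
    decide. [S] is arbitrary in order to cover the sigma-algebras of the past
    and of the future along with the full one. *)
Lemma coord_sigma_preimage T (S : set (set T)) (f : T -> zseq E) J :
  sigma_algebra setT S ->
  (forall t B, J t -> measurable B -> S ((fun w => f w t) @^-1` B)) ->
  forall A, coord_sigma J A -> S (f @^-1` A).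
Proof.
move=> sS fS A JA; suff: coord_sigma J `<=` image_set_system setT f S.
  by move=> /(_ _ JA); rewrite /image_set_system /= setTI.
apply: (@smallest_sub _ _ _ (image_set_system setT f S)) => [|_ [t Jt [B mB <-]]].
  by apply: sigma_algebra_image.
by rewrite /image_set_system /= !setTI; exact: fS.
Qed.

Lemma sub_coord_sigma I J A : I `<=` J ->
  @coord_sigma d E I A -> coord_sigma J A.
Proof.
move=> IJ; apply: (@coord_sigma_preimage _ _ idfun).
  exact: coord_sigma_algebra.
by move=> t B /IJ Jt mB; exact: coord_sigma_eval.
Qed.

Lemma coord_sigma_measurable I A : @coord_sigma d E I A -> measurable A.
Proof. exact: sub_coord_sigma. Qed.

Lemma measurable_coord t : measurable_fun setT (fun x : zseq E => x t).
Proof. by move=> _ B mB; rewrite setTI; apply: coord_sigma_eval. Qed.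

Lemma measurable_zseq dT (T : measurableType dT) (f : T -> zseq E) :
  (forall t, measurable_fun setT (fun w => f w t)) -> measurable_fun setT f.
Proof.
move=> mf _ A mA; rewrite setTI.
apply: (@coord_sigma_preimage _ measurable f setT) => //.
  exact: sigma_algebra_measurable.
by move=> t B _ mB; rewrite -[X in measurable X]setTI; exact: mf.
Qed.

(** The sets that do not separate [x] from [y] form a sigma-algebra, which
    contains the generators. *)
Lemma coord_sigma_sat I A x y : coord_sigma I A ->
  (forall t, I t -> x t = y t) -> A x = A y.
Proof.
move=> IA xy.
pose H := [set A : set (zseq E) | A x = A y].
suff: coord_sigma I `<=` H by apply.
apply: smallest_sub => [|_ [t It [B mB <-]]].
  split => [//|B|B HB]; first by rewrite /H /= => Bxy; apply/propext; split; case => _; rewrite ?Bxy// -?Bxy.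
  by rewrite /H/=; apply/propext; split => -[n _ Bn]; exists n => //; move: Bn; rewrite HB.
by rewrite /H /= /preimage /= xy.
Qed.

Lemma coord_sigma_splice I J A x y : J `<=` I -> coord_sigma J A ->
  A (splice I x y) = A x.
Proof.
move=> JI /coord_sigma_sat; apply => t /JI It.
by rewrite /splice; case: asboolP.
Qed.

Lemma coord_sigma_spliceC I J A x y : J `<=` ~` I -> coord_sigma J A ->
  A (splice I x y) = A y.
Proof.
move=> JI /coord_sigma_sat; apply => t /JI It.
by rewrite /splice; case: asboolP.
Qed.

Lemma measurable_splice I :
  measurable_fun setT (fun p : zseq E * zseq E => splice I p.1 p.2).
Proof.
apply: measurable_zseq => t; rewrite /splice; case: asboolP => _.
  by apply: measurableT_comp (measurable_coord t) measurable_fst.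
by apply: measurableT_comp (measurable_coord t) measurable_snd.
Qed.

Lemma measurable_shiftz h : measurable_fun setT (@shiftz E h).
Proof. by apply: measurable_zseq => t; exact: measurable_coord. Qed.

Lemma coord_sigma_shiftz h J I A : (forall t, J t -> I (t + h)) ->
  coord_sigma J A -> coord_sigma I (@shiftz E h @^-1` A).
Proof.
move=> JI; apply: coord_sigma_preimage; first exact: coord_sigma_algebra.
by move=> t B /JI It mB; exact: coord_sigma_eval.
Qed.

(** A converse of [coord_sigma_sat]: [A] is its own preimage under the map that
    freezes the coordinates outside [I]. *)
Lemma coord_sigma_factor I (A : set (zseq E)) : measurable A ->
  (forall x y, (forall t, I t -> x t = y t) -> A x -> A y) -> coord_sigma I A.
Proof.
move=> mA satA.
pose r (x : zseq E) := splice I x (fun=> point).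
have -> : A = r @^-1` A.
  by apply/seteqP; split => x; apply: satA => t It; rewrite /r /splice; case: asboolP.
apply: (@coord_sigma_preimage _ (coord_sigma I) r setT) => //.
  exact: coord_sigma_algebra.
move=> t B _ mB; rewrite /r /splice; case: asboolP => [It|nIt].
  exact: coord_sigma_eval.
have [s0 sC _] := @coord_sigma_algebra I.
have [Bp|nBp] := pselect (B point).
  rewrite (_ : _ @^-1` B = setT); last by apply/seteqP; split.
  by rewrite -setC0 -setTD; exact: sC.
by rewrite (_ : _ @^-1` B = set0); last by apply/seteqP; split.
Qed.

Lemma coord_sigmaI I A B : @coord_sigma d E I A -> coord_sigma I B ->
  coord_sigma I (A `&` B).
Proof.
move=> IA IB; apply: coord_sigma_factor.
  by apply: measurableI; [exact: coord_sigma_measurable IA|exact: coord_sigma_measurable IB].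
move=> x y xy; rewrite /setI/= => -[].
by rewrite (coord_sigma_sat IA xy) (coord_sigma_sat IB xy).
Qed.

Lemma coord_sigmaT I : @coord_sigma d E I setT.
Proof. exact: coord_sigma_factor. Qed.

(** A pi-system adapted to conditioning on the coordinates in [I]. *)
Definition split_rect I : set (set (zseq E)) :=
  [set C | exists A B, [/\ coord_sigma I A, coord_sigma (~` I) B & C = A `&` B]].

Lemma split_rectI I : setI_closed (split_rect I).
Proof.
move=> _ _ [A [B [IA IB ->]]] [A' [B' [IA' IB' ->]]].
exists (A `&` A'), (B `&` B'); split; [exact: coord_sigmaI..|].
by rewrite setIACA.
Qed.

Lemma split_rect_measurable I C : split_rect I C -> measurable C.
Proof.
move=> [A [B [IA IB ->]]].
by apply: measurableI; [exact: coord_sigma_measurable IA|exact: coord_sigma_measurable IB].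
Qed.

Lemma split_rect_gen I : @measurable _ (zseq E) = <<s split_rect I >>.
Proof.
apply/seteqP; split; last first.
  apply: smallest_sub; first exact: sigma_algebra_measurable.
  by move=> C; exact: split_rect_measurable.
apply: smallest_sub; first exact: smallest_sigma_algebra.
move=> _ [t _ [B mB <-]]; rewrite setTI; apply: sub_sigma_algebra.
rewrite /split_rect /=; have [It|nIt] := pselect (I t).
  exists ((fun x : zseq E => x t) @^-1` B), setT; split; rewrite ?setIT//.
  - exact: (coord_sigma_eval It mB).
  - exact: coord_sigmaT.
exists setT, ((fun x : zseq E => x t) @^-1` B); split; rewrite ?setTI//.
- exact: coord_sigmaT.
- exact: (@coord_sigma_eval (~` I) t B nIt mB).
Qed.

Definition window (N : nat) : set int := [set t | `|t|%N <= N]%N.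

(** Two of these, shifted far apart, depend on disjoint windows: this is how
    the noise mixes. *)
Definition cylinder : set (set (zseq E)) :=
  [set C | exists N, coord_sigma (window N) C].

Lemma cylinderI : setI_closed cylinder.
Proof.
move=> A B [M MA] [N NB]; exists (maxn M N); apply: coord_sigmaI.
  by apply: sub_coord_sigma MA => t /= tM; rewrite /window/= leq_max tM.
by apply: sub_coord_sigma NB => t /= tN; rewrite /window/= leq_max tN orbT.
Qed.

Lemma cylinder_measurable C : cylinder C -> measurable C.
Proof. by case=> N; exact: coord_sigma_measurable. Qed.

Lemma cylinder_gen : @measurable _ (zseq E) = <<s cylinder >>.
Proof.
apply/seteqP; split; last first.
  apply: smallest_sub; first exact: sigma_algebra_measurable.
  by move=> C; exact: cylinder_measurable.
apply: smallest_sub; first exact: smallest_sigma_algebra.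
move=> _ [t _ [B mB <-]]; rewrite setTI; apply: sub_sigma_algebra.
by exists `|t|%N; apply: (@coord_sigma_eval _ t B _ mB); exact: leqnn.
Qed.

End coordinates.

(** * The uniform law and pi-systems *)

Section uniform_law.
Variable R : realType.

Definition id_borel : measurableTypeR R -> R := idfun.

HB.instance Definition _ :=
  @isMeasurableFun.Build _ _ _ _ id_borel (@measurable_id _ _ setT).

(** [uniform_prob] is a probability on a copy of the reals with its own
    measurable structure; the identity transports it to [R]. *)
Definition unif : probability R R :=
  distribution (uniform_prob (@ltr01 R)) (id_borel : {mfun _ >-> R}).

Lemma unifE (A : set R) : measurable A ->
  unif A = lebesgue_measure (A `&` `[0, 1]).
Proof.
move=> mA; rewrite /unif/= /distribution /pushforward /= /uniform_prob.
rewrite integral_uniform_pdf (eq_integral (fun=> 1%E)); last first.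
  move=> x; rewrite inE/= /uniform_pdf => -[_]; rewrite in_itv/= => ->.
  by rewrite subr0 invr1.
by rewrite integral_cst ?mul1e//; exact: measurableI.
Qed.

(** The distribution function of the uniform law. *)
Definition clamp (a : R) : R := if a <= 0 then 0 else if a <= 1 then a else 1.

Lemma clamp_id a : 0 <= a <= 1 -> clamp a = a.
Proof.
move=> /andP[a0 a1]; rewrite /clamp a1; case: ifPn => // a0'.
by apply/eqP; rewrite eq_le a0 a0'.
Qed.

Lemma clamp_lt0 a : a <= 0 -> clamp a = 0.
Proof. by rewrite /clamp => ->. Qed.

Lemma clamp_gt1 a : 1 <= a -> clamp a = 1.
Proof.
move=> a1; rewrite /clamp leNgt (lt_le_trans ltr01 a1)/=.
by case: ifPn => // a1'; apply/eqP; rewrite eq_le a1 a1'.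
Qed.

Lemma clamp_ge0 a : 0 <= clamp a.
Proof. by rewrite /clamp; case: ifPn => //; case: ifPn => // _; rewrite -ltNge => /ltW. Qed.

Lemma clamp_le1 a : clamp a <= 1.
Proof. by rewrite /clamp; case: ifPn => //; case: ifPn. Qed.

Lemma unif_itv (i : interval R) (a b : R) :
  (forall x, (x \in i) && (0 <= x <= 1) -> a <= x <= b) ->
  (forall x, a < x < b -> (x \in i) && (0 <= x <= 1)) -> a <= b ->
  unif [set` i] = (b - a)%:E.
Proof.
have mI : measurable ([set` i] `&` `[0, 1] : set R) by exact: measurableI.
move=> iab abi ab; rewrite unifE//; apply/eqP; rewrite eq_le; apply/andP; split.
  apply: (@le_trans _ _ (lebesgue_measure `[a, b]%classic)).
    apply: le_measure; rewrite ?inE; [exact: mI|exact: measurable_itv|].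
    move=> x [/= ix]; rewrite !in_itv/= => x01; apply: iab.
    by rewrite ix x01.
  rewrite lebesgue_measure_itv/= lte_fin; case: ltP => // _.
  by rewrite lee_fin subr_ge0.
apply: (@le_trans _ _ (lebesgue_measure `]a, b[%classic)).
  rewrite lebesgue_measure_itv/= lte_fin; case: ltgtP ab => // -> _.
  by rewrite subrr.
apply: le_measure; rewrite ?inE; [exact: measurable_itv|exact: mI|].
by move=> x /=; rewrite in_itv/= => /abi/andP[xi x01].
Qed.

Lemma unif_le a : unif `]-oo, a]%classic = (clamp a)%:E.
Proof.
rewrite -[clamp a]subr0; apply: unif_itv; last exact: clamp_ge0.
  move=> x /andP[]; rewrite in_itv/= => xa /andP[x0 x1]; rewrite x0/=.
  rewrite /clamp; case: ifPn => a0; first exact: (le_trans xa).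
  by case: ifPn.
move=> x /andP[x0 xa]; rewrite in_itv/= (ltW x0) (le_trans (ltW xa) (clamp_le1 _)) !andbT.
move: x0 xa; rewrite /clamp; case: ifPn => a0.
  by move=> x0 /(lt_trans x0); rewrite ltxx.
case: ifPn => [_ _ xa|]; first exact: ltW.
by rewrite -ltNge => a1 _ xa; exact: (le_trans (ltW xa) (ltW a1)).
Qed.

Lemma unif_lt a : unif `]-oo, a[%classic = (clamp a)%:E.
Proof.
rewrite -[clamp a]subr0; apply: unif_itv; last exact: clamp_ge0.
  move=> x /andP[]; rewrite in_itv/= => xa /andP[x0 x1]; rewrite x0/=.
  rewrite /clamp; case: ifPn => a0; first exact: (le_trans (ltW xa)).
  by case: ifPn => // _; exact: ltW.
move=> x /andP[x0 xa]; rewrite in_itv/= (ltW x0) (le_trans (ltW xa) (clamp_le1 _)) !andbT.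
move: x0 xa; rewrite /clamp; case: ifPn => a0.
  by move=> x0 /(lt_trans x0); rewrite ltxx.
case: ifPn => [_ _ //|]; rewrite -ltNge => a1 _ xa.
exact: (lt_trans xa a1).
Qed.

End uniform_law.

Section pi_systems.
Variable R : realType.

Definition to_mfun d1 d2 (T1 : measurableType d1) (T2 : measurableType d2)
  (f : T1 -> T2) (mf : measurable_fun setT f) : {mfun T1 >-> T2} :=
  mfun_Sub (mem_set mf).

(** Two finite measures of equal total mass that agree on a generating
    pi-system are equal; apply this to the law of [X] restricted to [B], and to
    [Q] scaled by the probability of [B]. *)
Lemma indep_law_pi d1 d2 (T1 : measurableType d1) (T2 : measurableType d2)
    (P : probability T1 R) (Q : probability T2 R) (B : set T1) (X : T1 -> T2)
    (G : set (set T2)) :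
  measurable B -> measurable_fun setT X ->
  @measurable _ T2 = <<s G >> -> setI_closed G ->
  (forall A, G A -> P (B `&` X @^-1` A) = P B * Q A)%E ->
  forall A, measurable A -> (P (B `&` X @^-1` A) = P B * Q A)%E.
Proof.
move=> mB mX gG GI PQ A mA.
have pB0 : (0 <= fine (P B))%R by exact: fine_ge0.
have [m1 m1E] : exists m1 : {measure set T2 -> \bar R},
    forall C, m1 C = P (B `&` X @^-1` C).
  pose m1 : {measure set T2 -> \bar R} := pushforward (mrestr P mB) X.
  by exists (m1 mX) => C; rewrite setIC.
pose m2 : {measure set T2 -> \bar R} := mscale (NngNum pB0) Q.
have m2E C : m2 C = (P B * Q C)%E.
  by rewrite /m2 /= /mscale/= fineK// fin_num_measure.
rewrite -m1E -m2E.
pose G' := [set C | G C \/ C = setT].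
apply: (@measure_unique _ _ _ G' (fun=> setT)) => //.
- apply/seteqP; split.
    rewrite gG; apply: smallest_sub; first exact: smallest_sigma_algebra.
    by move=> C GC; apply: sub_sigma_algebra; left.
  apply: smallest_sub; first exact: sigma_algebra_measurable.
  by move=> C [GC|->//]; rewrite gG; exact: sub_sigma_algebra.
- move=> C D [GC|->] [GD|->]; rewrite ?setIT ?setTI.
  + by left; exact: GI.
  + by left.
  + by left.
  + by right.
- by move=> _; right.
- by rewrite bigcup_const//; exists 0.
- move=> C [GC|->]; first by rewrite m1E m2E PQ.
  by rewrite m1E m2E preimage_setT setIT probability_setT mule1.
- by move=> _; rewrite m1E preimage_setT setIT ltey_eq fin_num_measure.
Qed.

(** The special case of a sure event: equality of two laws. *)
Lemma eq_law_pi d1 d2 (T1 : measurableType d1) (T2 : measurableType d2)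
    (P : probability T1 R) (Q : probability T2 R) (X : T1 -> T2)
    (G : set (set T2)) :
  measurable_fun setT X -> @measurable _ T2 = <<s G >> -> setI_closed G ->
  (forall A, G A -> P (X @^-1` A) = Q A)%E ->
  forall A, measurable A -> (P (X @^-1` A) = Q A)%E.
Proof.
move=> mX gG GI PQ A mA.
have PQ' C : G C -> (P (setT `&` X @^-1` C) = P setT * Q C)%E.
  by rewrite setTI probability_setT mul1e; exact: PQ.
have := indep_law_pi measurableT mX gG GI PQ' mA.
by rewrite setTI probability_setT mul1e.
Qed.

Lemma product_probE d1 d2 (T1 : measurableType d1) (T2 : measurableType d2)
    (P : probability T1 R) (Q : probability T2 R) A B :
  measurable A -> measurable B -> (P \x Q)%E (A `*` B) = (P A * Q B)%E.
Proof. by move=> mA mB; exact: product_measure1E. Qed.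

Definition rays : set (set R) := [set B | exists a, B = `]-oo, a]%classic].

Lemma rays_gen : @measurable _ R = <<s rays >>.
Proof.
rewrite [LHS](_ : _ = @measurable _ (measurableTypeR R))//.
rewrite [LHS](RGenOInfty.measurableE R); apply/seteqP; split.
  apply: smallest_sub; first exact: smallest_sigma_algebra.
  move=> _ [a ->]; rewrite -setCitvl -setTD.
  have [_ + _] := smallest_sigma_algebra setT rays; apply.
  by apply: sub_sigma_algebra; exists a.
apply: smallest_sub; first exact: smallest_sigma_algebra.
move=> _ [a ->].
have -> : `]-oo, a]%classic = setT `\` `]a, +oo[%classic by rewrite setTD setCitvr.
have [_ + _] := smallest_sigma_algebra setT (@RGenOInfty.G R); apply.
by apply: sub_sigma_algebra; exists a.
Qed.

Lemma raysI : setI_closed rays.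
Proof.
move=> _ _ [a ->] [b ->]; exists (Num.min a b).
apply/seteqP; split => x /=; rewrite !in_itv/= le_min.
  by case=> -> ->.
by move=> /andP[].
Qed.

End pi_systems.

(** * Binary digits of a uniform variable *)

Section binary_digits.
Variable R : realType.
Local Notation unif := (unif R).

Definition bit (x : R) : bool := 2^-1 <= x.
Definition dbl (x : R) : R := 2 * x - (bit x)%:R.

Lemma measurable_bit : measurable_fun setT bit.
Proof. by apply: measurable_fun_ler => //; exact: measurable_id. Qed.

Lemma measurable_bitr : measurable_fun setT (fun x => (bit x)%:R : R).
Proof.
rewrite (_ : (fun x => _) = (fun x => if bit x then 1 else 0 : R)).
  by apply: measurable_fun_ifT => //; exact: measurable_bit.
by apply/funext => x; case: (bit x).
Qed.

Lemma measurable_dbl : measurable_fun setT dbl.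
Proof.
apply: measurable_funB; last exact: measurable_bitr.
by apply: measurable_funM => //; exact: measurable_id.
Qed.

Lemma measurable_bit_eq c : measurable [set x | bit x = c].
Proof.
rewrite (_ : [set x | _] = setT `&` bit @^-1` [set c]); last by rewrite setTI.
exact: measurable_bit.
Qed.

Lemma unif_bit c : unif [set x | bit x = c] = (2^-1)%:E.
Proof.
have uF : unif [set x | bit x = false] = (2^-1)%:E.
  rewrite (_ : [set x | _] = `]-oo, 2^-1[%classic); last first.
    apply/seteqP; split => x /=; rewrite in_itv/= /bit ltNge; first by move=> ->.
    by move=> /negbTE.
  by rewrite unif_lt clamp_id//; lra.
case: c => //.
rewrite (_ : [set x | _] = ~` [set x | bit x = false]); last first.
  by apply/seteqP; split => x /=; case: (bit x).
rewrite probability_setC; last exact: measurable_bit_eq.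
by rewrite [X in (_ - X)%E]uF -EFinB; congr EFin; lra.
Qed.

(** The first binary digit of a uniform variable is a fair coin, independent of
    the remaining digits: on each half of the unit interval, the preimage of a
    ray under [dbl] has half the mass of the ray. *)
Lemma unif_dbl c A : measurable A ->
  unif ([set x | bit x = c] `&` dbl @^-1` A) = ((2^-1)%:E * unif A)%E.
Proof.
move=> mA; rewrite -(unif_bit c).
apply: (@indep_law_pi _ _ _ _ _ unif unif _ dbl (@rays R)) => //.
- exact: measurable_bit_eq.
- exact: measurable_dbl.
- exact: rays_gen.
- exact: raysI.
move=> _ [a ->]; rewrite unif_bit [X in (_ * X)%E]unif_le -EFinM; case: c.
  rewrite (_ : _ `&` _ = [set` `[2^-1, (a + 1) / 2]]); last first.
    apply/seteqP; split => x /=; rewrite !in_itv/= /dbl.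
      by rewrite /bit => -[xh]; rewrite xh/= => xa; lra.
    by move=> /andP[xh xa]; rewrite /bit xh/=; split => //; lra.
  rewrite (@unif_itv _ _ 2^-1 (2^-1 + 2^-1 * clamp a)); first last.
  - by have := clamp_ge0 a; lra.
  - move=> x /andP[x1]; rewrite in_itv/= /clamp.
    by case: (leP a 0) => a0; [|case: (leP a 1) => a1]; move=> x2;
      lra.
  - move=> x /andP[]; rewrite in_itv/= => /andP[x1 x2] /andP[x3 x4].
    rewrite x1/= /clamp; case: (leP a 0) => a0; first lra.
    by case: (leP a 1) => a1; lra.
  by congr EFin; lra.
have [a1|a1] := ltP a 1.
  rewrite (_ : _ `&` _ = `]-oo, a / 2]%classic); last first.
    apply/seteqP; split => x /=; rewrite !in_itv/= /dbl.
      by move=> [-> /=] xa; lra.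
    move=> xa; have bx : bit x = false by apply/negbTE; rewrite /bit -ltNge; lra.
    by rewrite bx/=; split => //; lra.
  rewrite [LHS]unif_le; congr EFin; rewrite /clamp.
  by case: (leP a 0) => a0; case: (leP (a / 2) 0) => a2; rewrite ?mulr0//; try lra;
     do ?[case: ifPn => ?]; lra.
rewrite (_ : _ `&` _ = `]-oo, 2^-1[%classic); last first.
  apply/seteqP; split => x /=; rewrite !in_itv/= /dbl.
    by move=> [bx _]; move/negbT: bx; rewrite /bit -ltNge.
  move=> xa; have bx : bit x = false by apply/negbTE; rewrite /bit -ltNge.
  by rewrite bx/=; split => //; lra.
by rewrite [LHS]unif_lt clamp_id; [rewrite clamp_gt1//; congr EFin; lra|lra].
Qed.

End binary_digits.

(** * Splitting a uniform variable into independent ones *)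

Section splitting.
Variable R : realType.
Local Notation unif := (unif R).
Local Notation bit := (@bit R).
Local Notation dbl := (@dbl R).

(** Partial sums of the number whose binary digits are every other digit of
    [x]: two digits of [x] are consumed for each digit produced. *)
Fixpoint even_approx n (x : R) : R :=
  if n is n'.+1 then 2^-1 * ((bit x)%:R + even_approx n' (dbl (dbl x))) else 0.

Definition even_digits (x : R) : R := limn (even_approx ^~ x).
Definition odd_digits (x : R) : R := even_digits (dbl x).

Lemma bit01 x : 0 <= ((bit x)%:R : R) <= 1.
Proof. by case: (bit x); rewrite ?ler01 lexx. Qed.

Lemma even_approx01 n x : 0 <= even_approx n x <= 1.
Proof.
elim: n x => [|n IH] x /=; first by rewrite lexx ler01.
by have := IH (dbl (dbl x)); have := bit01 x; lra.
Qed.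

Lemma even_approx_nd x : nondecreasing_seq (even_approx ^~ x).
Proof.
apply/nondecreasing_seqP => n; elim: n x => [|n IH] x.
  by have /andP[] := even_approx01 1 x.
by rewrite /= ler_wpM2l// lerD2l; exact: IH.
Qed.

Lemma even_approx_cvg x : even_approx n x @[n --> \oo] --> even_digits x.
Proof.
apply: nondecreasing_is_cvgn; first exact: even_approx_nd.
by exists 1 => _ [n _ <-]; have /andP[] := even_approx01 n x.
Qed.

Lemma even_digits01 x : 0 <= even_digits x <= 1.
Proof.
apply/andP; split.
  apply: limr_ge; first exact: even_approx_cvg.
  by apply: nearW => n; have /andP[] := even_approx01 n x.
apply: limr_le; first exact: even_approx_cvg.
by apply: nearW => n; have /andP[] := even_approx01 n x.
Qed.

Lemma even_digitsE x :
  even_digits x = 2^-1 * ((bit x)%:R + even_digits (dbl (dbl x))).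
Proof.
have h1 : [sequence even_approx n.+1 x]_n @ \oo --> even_digits x.
  by rewrite (cvg_shiftS (even_approx ^~ x)); exact: even_approx_cvg.
have h2 : [sequence even_approx n.+1 x]_n @ \oo -->
    2^-1 * ((bit x)%:R + even_digits (dbl (dbl x))).
  apply: cvgMr; apply: cvgD; first exact: cvg_cst.
  exact: even_approx_cvg.
exact: (cvg_unique _ h1 h2).
Qed.

Lemma measurable_even_digits : measurable_fun setT even_digits.
Proof.
apply: (@measurable_fun_cvg _ _ _ _ even_approx) => [n|x _]; last first.
  exact: even_approx_cvg.
elim: n => [|n IH] /=; first exact: measurable_cst.
apply: measurable_funM => //; apply: measurable_funD.
  exact: measurable_bitr.
apply: measurableT_comp IH _.
by apply: measurableT_comp; exact: measurable_dbl.
Qed.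

Lemma measurable_odd_digits : measurable_fun setT odd_digits.
Proof.
by apply: measurableT_comp; [exact: measurable_even_digits|exact: measurable_dbl].
Qed.

Definition quadrant (a c : R) : set R :=
  [set x | even_digits x <= a /\ odd_digits x <= c].

Lemma quadrantE a c : quadrant a c =
  even_digits @^-1` `]-oo, a] `&` odd_digits @^-1` `]-oo, c].
Proof. by apply/seteqP; split => x /=; rewrite !in_itv. Qed.

Lemma measurable_quadrant a c : measurable (quadrant a c).
Proof.
rewrite quadrantE; apply: measurableI.
  by rewrite -[X in measurable X]setTI; exact: measurable_even_digits.
by rewrite -[X in measurable X]setTI; exact: measurable_odd_digits.
Qed.

Let M (a c : R) : R := fine (unif (quadrant a c)).

Let ME a c : unif (quadrant a c) = (M a c)%:E.
Proof. by rewrite fineK// fin_num_measure//; exact: measurable_quadrant. Qed.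

(* Doubling consumes the first digit and exchanges the two subsequences:
   even_digits x <= a iff odd_digits (dbl x) <= 2 a - bit x. *)
Let M_rec a c : M a c = 2^-1 * (M c (2 * a) + M c (2 * a - 1)).
Proof.
apply: EFin_inj; rewrite EFinM EFinD -!ME.
have quadI b : quadrant a c `&` [set x | bit x = b] =
    [set x | bit x = b] `&` dbl @^-1` quadrant c (2 * a - b%:R).
  apply/seteqP; split => x; rewrite /quadrant /= /odd_digits /=.
    move=> [[+ ?] xb]; rewrite even_digitsE xb => ?.
    by split => //; split => //; lra.
  move=> [xb [? ?]]; split => //; split => //.
  by rewrite even_digitsE xb; lra.
rewrite -[X in unif X]setIT (_ : setT = [set x | bit x = true] `|` [set x | bit x = false]); last first.
  by apply/seteqP; split => x _ //=; case: (bit x); [left|right].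
rewrite setIUr measureU; first last.
- by apply/seteqP; split => x //= [[_ ->] []].
- by apply: measurableI; [exact: measurable_quadrant|exact: measurable_bit_eq].
- by apply: measurableI; [exact: measurable_quadrant|exact: measurable_bit_eq].
have quadU b : unif (quadrant a c `&` [set x | bit x = b]) =
    (2^-1 * M c (2 * a - b%:R))%:E.
  by rewrite quadI unif_dbl ?ME -?EFinM//; exact: measurable_quadrant.
by rewrite /= !quadU !ME -EFinD -EFinD -EFinM; congr EFin; rewrite subr0 addrC mulrDr.
Qed.

Let err a c := M a c - clamp a * clamp c.

Let clamp_rec (a : R) : clamp a = 2^-1 * (clamp (2 * a) + clamp (2 * a - 1)).
Proof.
have [a0|a0] := leP a 0; first by rewrite !clamp_lt0; lra.
have [a1|a1] := leP 1 a; first by rewrite !clamp_gt1; lra.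
have [ah|ah] := leP (2 * a) 1.
  by rewrite (@clamp_lt0 _ (2 * a - 1)) ?clamp_id; lra.
by rewrite (@clamp_gt1 _ (2 * a)) ?clamp_id; lra.
Qed.

Let err_rec a c : err a c = 2^-1 * (err c (2 * a) + err c (2 * a - 1)).
Proof. by rewrite /err M_rec (clamp_rec a); lra. Qed.

Let err_lt0l a c : a < 0 -> err a c = 0.
Proof.
move=> a0; rewrite /err /M (_ : quadrant a c = set0); last first.
  apply/seteqP; split => x //= -[/= xa _].
  by have /andP[] := even_digits01 x; lra.
by rewrite measure0 clamp_lt0 ?mul0r ?subr0// ltW.
Qed.

Let err_lt0r a c : c < 0 -> err a c = 0.
Proof.
move=> c0; rewrite /err /M (_ : quadrant a c = set0); last first.
  apply/seteqP; split => x //= -[/= _ xc].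
  by have /andP[] := even_digits01 (dbl x); rewrite /odd_digits in xc; lra.
by rewrite measure0 [clamp c]clamp_lt0 ?mulr0 ?subr0// ltW.
Qed.

Let err_ge1 a c : 1 <= a -> 1 <= c -> err a c = 0.
Proof.
move=> a1 c1; rewrite /err /M (_ : quadrant a c = setT); last first.
  apply/seteqP; split => x //= _; split.
    by have /andP[_ /le_trans] := even_digits01 x; apply.
  by have /andP[_ /le_trans] := even_digits01 (dbl x); apply.
by rewrite probability_setT !clamp_gt1//= mulr1 subrr.
Qed.

(* Of the four terms of the second-order recursion one at least vanishes:
   each step contracts the error by 3/4. *)
Let err_bound n a c : `|err a c| <= (3 / 4) ^+ n.
Proof.
elim: n a c => [|n IH] a c.
  rewrite expr0 ler_norml /err.
  have M0 : 0 <= M a c by exact: fine_ge0.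
  have M1 : M a c <= 1.
    by rewrite -lee_fin -ME; apply: probability_le1; exact: measurable_quadrant.
  have := mulr_ge0 (clamp_ge0 a) (clamp_ge0 c).
  have : clamp a * clamp c <= 1.
    by rewrite mulr_ile1 ?clamp_ge0 ?clamp_le1.
  by lra.
rewrite err_rec (err_rec c) (err_rec c (2 * a - 1)) exprS.
move: (IH (2 * a) (2 * c)) (IH (2 * a) (2 * c - 1)) (IH (2 * a - 1) (2 * c)) (IH (2 * a - 1) (2 * c - 1)).
rewrite !ler_norml; set t := (3 / 4) ^+ n => h1 h2 h3 h4.
have [a2|a2] := ltP (2 * a - 1) 0.
  by move: h3 h4; rewrite (err_lt0l _ a2) (err_lt0l _ a2); lra.
have [c2|c2] := ltP (2 * c - 1) 0.
  by move: h2 h4; rewrite (err_lt0r _ c2) (err_lt0r _ c2); lra.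
by move: h1; rewrite err_ge1; lra.
Qed.

Let err0 a c : err a c = 0.
Proof.
apply/eqP; apply: contraT => e0.
have : (3 / 4 : R) ^+ n @[n --> \oo] --> 0 by apply: cvg_expr; rewrite ger0_norm; lra.
move=> /cvgr0_norm_lt /(_ `|err a c|); rewrite normr_gt0 => /(_ e0)[n _ /(_ n)] /=.
move=> /(_ (leqnn n)); rewrite ger0_norm; last by apply: exprn_ge0; lra.
by rewrite ltNge err_bound.
Qed.

(** The product law obeys the recursion [M_rec] too, and that recursion contracts
    the difference of the two solutions ([err_bound]). *)
Lemma unif_quadrant a c : unif (quadrant a c) = (clamp a * clamp c)%:E.
Proof. by rewrite ME; congr EFin; apply/eqP; rewrite -subr_eq0; apply/eqP/err0. Qed.

Let unif_even A : measurable A -> unif (even_digits @^-1` A) = unif A.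
Proof.
apply: (@eq_law_pi _ _ _ _ _ unif unif _ (@rays R)).
- exact: measurable_even_digits.
- exact: rays_gen.
- exact: raysI.
move=> _ [a ->]; rewrite [RHS]unif_le -[clamp a]mulr1 -(@clamp_gt1 _ 1)//.
rewrite -unif_quadrant; congr (unif _); apply/seteqP; split => x /=; rewrite in_itv/=.
  by move=> xa; split => //; have /andP[] := even_digits01 (dbl x).
by case.
Qed.

Let unif_odd_ray c : unif (odd_digits @^-1` `]-oo, c]) = (clamp c)%:E.
Proof.
rewrite -[clamp c]mul1r -(@clamp_gt1 _ 1)//.
rewrite -unif_quadrant; congr (unif _); apply/seteqP; split => x /=; rewrite in_itv/=.
  by move=> xa; split => //; have /andP[] := even_digits01 x.
by case.
Qed.

Lemma unif_split A B : measurable A -> measurable B ->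
  unif (even_digits @^-1` A `&` odd_digits @^-1` B) = (unif A * unif B)%E.
Proof.
move=> mA mB; rewrite -(unif_even mA).
apply: (@indep_law_pi _ _ _ _ _ unif unif _ odd_digits (@rays R)) => //.
- by rewrite -[X in measurable X]setTI; exact: measurable_even_digits.
- exact: measurable_odd_digits.
- exact: rays_gen.
- exact: raysI.
move=> _ [c ->]; rewrite [X in (_ * X)%E]unif_le -unif_odd_ray setIC muleC (unif_even mA).
apply: (@indep_law_pi _ _ _ _ _ unif unif _ even_digits (@rays R)) => //.
- by rewrite -[X in measurable X]setTI; exact: measurable_odd_digits.
- exact: measurable_even_digits.
- exact: rays_gen.
- exact: raysI.
move=> _ [a ->]; rewrite [X in (_ * X)%E]unif_le unif_odd_ray -EFinM mulrC.
by rewrite setIC -quadrantE unif_quadrant.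
Qed.

(** The odd digits are a reservoir, split again for each new variable. *)
Definition noise (j : nat) (x : R) : R := even_digits (iter j odd_digits x).

Lemma measurable_iter_odd j : measurable_fun setT (iter j odd_digits).
Proof.
elim: j => [|j IH]; first exact: measurable_id.
by apply: measurableT_comp IH; exact: measurable_odd_digits.
Qed.

Lemma measurable_noise j : measurable_fun setT (noise j).
Proof.
by apply: measurableT_comp (measurable_iter_odd j); exact: measurable_even_digits.
Qed.

Lemma unif_noise n (A : nat -> set R) : (forall j, measurable (A j)) ->
  unif [set x | forall j, (j < n)%N -> A j (noise j x)] =
  (\prod_(j < n) fine (unif (A j)))%:E.
Proof.
elim: n A => [|n IH] A mA.
  rewrite big_ord0 (_ : [set x | _] = setT) ?probability_setT//.
  by apply/seteqP; split.
rewrite big_ord_recl EFinM fineK ?fin_num_measure// -(IH (fun j => A j.+1))//.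
set B := (X in (_ * unif X)%E).
have mB : measurable B.
  rewrite (_ : B = \bigcap_j (if (j < n)%N then noise j @^-1` A j.+1 else setT)); last first.
    apply/seteqP; split => x Bx j; first by move=> _ /=; case: ifP => // /Bx.
    by move=> jn; have := Bx j I; rewrite jn.
  apply: bigcapT_measurable => j; case: ifP => // _.
  by rewrite -[X in measurable X]setTI; exact: measurable_noise.
rewrite -unif_split//; congr (unif _); apply/seteqP; split => x /=.
  move=> Ax; split; first exact: (Ax 0%N).
  by move=> j jn; have := Ax j.+1 jn; rewrite /noise iterSr.
by move=> [A0 Bx] [|j] jn //; have := Bx j jn; rewrite /noise iterSr.
Qed.

End splitting.

(** * Independent identically distributed noise *)

Section iid_sequences.
Context d (E : measurableType d) (R : realType) (q : probability E R).

Definition rect (F : seq int) (A : int -> set E) : set (zseq E) :=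
  [set z | forall t, t \in F -> A t (z t)].

Definition rects : set (set (zseq E)) :=
  [set C | exists F A, [/\ uniq F, forall t, measurable (A t) & C = rect F A]].

Lemma measurable_rect F A : (forall t, measurable (A t)) -> measurable (rect F A).
Proof.
move=> mA; elim: F => [|t F IH].
  by rewrite (_ : rect _ _ = setT)//; apply/seteqP; split.
rewrite (_ : rect _ _ = (fun z : zseq E => z t) @^-1` A t `&` rect F A).
  by apply: measurableI => //; apply: (@coord_sigma_eval _ _ setT).
apply/seteqP; split => z.
  by move=> zA; split; [apply: zA; rewrite mem_head|move=> s sF; apply: zA; rewrite inE sF orbT].
by move=> [zt zF] s; rewrite inE => /predU1P[->//|]; exact: zF.
Qed.

Lemma rects_gen : @measurable _ (zseq E) = <<s rects >>.
Proof.
apply/seteqP; split.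
  apply: smallest_sub; first exact: smallest_sigma_algebra.
  move=> _ [t _ [B mB <-]]; rewrite setTI; apply: sub_sigma_algebra.
  exists [:: t], (fun=> B); split => //.
  by apply/seteqP; split => z /=; [move=> Bz s; rewrite inE => /eqP ->|apply; rewrite inE].
apply: smallest_sub; first exact: sigma_algebra_measurable.
by move=> _ [F [A [_ mA ->]]]; exact: measurable_rect.
Qed.

Lemma rectsI : setI_closed rects.
Proof.
move=> _ _ [F [A [uF mA ->]]] [G [B [uG mB ->]]].
exists (undup (F ++ G)), (fun t => (if t \in F then A t else setT) `&`
                                   (if t \in G then B t else setT)).
split; first exact: undup_uniq.
  by move=> t; apply: measurableI; case: ifP.
apply/seteqP; split => z /=.
  by move=> [zA zB] t _; split; case: ifP => //; [exact: zA|exact: zB].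
move=> zAB; split => t tF; have [] := zAB t; rewrite ?mem_undup ?mem_cat ?tF ?orbT//.
Qed.

Definition iid_law (tau : probability (zseq E) R) : Prop :=
  forall F A, uniq F -> (forall t, measurable (A t)) ->
    tau (rect F A) = (\prod_(t <- F) fine (q (A t)))%:E.

Variable tau : probability (zseq E) R.
Hypothesis iid_tau : iid_law tau.

Lemma iid_law_unique dT (T : measurableType dT) (P : probability T R)
    (X : T -> zseq E) : measurable_fun setT X ->
  (forall F A, uniq F -> (forall t, measurable (A t)) ->
    P (X @^-1` rect F A) = (\prod_(t <- F) fine (q (A t)))%:E) ->
  forall C, measurable C -> P (X @^-1` C) = tau C.
Proof.
move=> mX PX; apply: (@eq_law_pi _ _ _ _ _ P tau X rects) => //.
- exact: rects_gen.
- exact: rectsI.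
by move=> _ [F [A [uF mA ->]]]; rewrite PX// iid_tau.
Qed.

Lemma iid_marginal t A : measurable A -> tau ((fun z => z t) @^-1` A) = q A.
Proof.
move=> mA; rewrite (_ : _ @^-1` _ = rect [:: t] (fun=> A)); last first.
  by apply/seteqP; split => z /=; [move=> Bz s; rewrite inE => /eqP ->|apply; rewrite inE].
by rewrite iid_tau// big_seq1 fineK// fin_num_measure.
Qed.

Lemma iid_shift h C : measurable C -> tau (@shiftz E h @^-1` C) = tau C.
Proof.
apply: iid_law_unique; first exact: measurable_shiftz.
move=> F A uF mA.
rewrite (_ : _ @^-1` _ = rect [seq t + h | t <- F] (fun t => A (t - h))).
  rewrite iid_tau//; last by rewrite map_inj_uniq//; exact: addIr.
  by rewrite big_map; under eq_bigr do rewrite addrK.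
apply/seteqP; split => z /=.
  by move=> zA _ /mapP[t tF ->]; rewrite addrK; exact: zA.
by move=> zA t tF; have := zA (t + h); rewrite addrK; apply; exact: map_f.
Qed.

(** The form in which independence across disjoint sets of times is used: the
    noise outside [I] may be replaced by an independent copy. *)
Lemma iid_splice I C : measurable C ->
  (tau \x tau)%E ((fun p => splice I p.1 p.2) @^-1` C) = tau C.
Proof.
apply: (@iid_law_unique _ _ (tau \x tau)%E); first exact: measurable_splice.
move=> F A uF mA.
rewrite (_ : _ @^-1` _ = rect [seq t <- F | `[< I t >]] A `*`
                         rect [seq t <- F | ~~ `[< I t >]] A).
  rewrite [LHS]product_probE; [|exact: measurable_rect..].
  rewrite !iid_tau//; [|exact: filter_uniq..].
  by rewrite !big_filter -EFinM [in RHS](bigID (fun t => `[< I t >])).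
apply/seteqP; split => -[y z] /=.
  move=> yzA; split => t; rewrite mem_filter => /andP[It tF];
    have := yzA t tF; rewrite /splice/= ?It//.
  by rewrite (negbTE It).
move=> [yA zA] t tF; rewrite /splice/=; case: ifPn => It.
  by apply: yA; rewrite mem_filter It.
by apply: zA; rewrite mem_filter It.
Qed.

Lemma iid_indep I A B : coord_sigma I A -> coord_sigma (~` I) B ->
  tau (A `&` B) = (tau A * tau B)%E.
Proof.
move=> IA IB.
have mA := coord_sigma_measurable IA; have mB := coord_sigma_measurable IB.
rewrite -(iid_splice I); last exact: measurableI.
transitivity ((tau \x tau)%E (A `*` B)); last exact: product_probE.
congr ((_ \x _)%E _).
apply/seteqP; split => -[y z]; rewrite /setI/setX/preimage /=.
  by rewrite (coord_sigma_splice _ _ _ IA)// (coord_sigma_spliceC _ _ _ IB).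
by rewrite (coord_sigma_splice _ _ _ IA)// (coord_sigma_spliceC _ _ _ IB).
Qed.

End iid_sequences.

Section uniform_noise.
Variable R : realType.

(* [pickle] numbers the times, so that distinct times read disjoint sets of
   digits. *)
Let noise_seq (x : R) : zseq R := fun t => noise (pickle t) x.

Let measurable_noise_seq : measurable_fun setT noise_seq.
Proof. by apply: measurable_zseq => t; exact: measurable_noise. Qed.

Definition unif_noise_law : probability (zseq R) R :=
  distribution (unif R) (to_mfun measurable_noise_seq).

Lemma iid_unif_noise : iid_law (unif R) unif_noise_law.
Proof.
move=> F A uF mA; rewrite [LHS](_ : _ = unif R (noise_seq @^-1` rect F A))//.
pose F' := map pickle F.
pose n := (\max_(j <- F') j).+1.
pose A' j := if j \in F' then A (odflt 0 (unpickle j)) else setT.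
rewrite (_ : _ @^-1` _ = [set x | forall j, (j < n)%N -> A' j (noise j x)]).
  rewrite unif_noise; last by move=> j; rewrite /A'; case: ifP.
  congr EFin; rewrite -(big_mkord xpredT (fun j => fine (unif R (A' j)))).
  rewrite (bigID (mem F'))/= [X in _ * X]big1 ?mulr1; last first.
    by move=> j /negbTE jF; rewrite /A' jF probability_setT.
  rewrite -big_filter (perm_big F').
    rewrite big_map; apply: eq_big_seq => t tF.
    by rewrite /A' map_f//= pickleK.
  apply: uniq_perm; first by rewrite filter_uniq// iota_uniq.
    by rewrite map_inj_uniq//; exact: (pcan_inj pickleK).
  move=> j; rewrite mem_filter mem_index_iota/= andb_idr// => jF.
  by rewrite ltnS; exact: leq_bigmax_seq.
apply/seteqP; split => x /=.
  move=> xA j _; rewrite /A'; case: ifP => // /mapP[t tF ->].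
  by rewrite pickleK/=; exact: xA.
move=> xA t tF; have := xA (pickle t); rewrite /A' map_f//= pickleK/=; apply.
by rewrite ltnS; apply: leq_bigmax_seq => //; exact: map_f.
Qed.

End uniform_noise.

(** * Quantiles and the distributional transform *)

Section quantile_transform.
Variables (R : realType) (rho : probability R R).

Definition cdf_of (x : R) : \bar R := rho `]-oo, x]%classic.

(** The values at [x] and just before [x], as real numbers: the two ends of the
    jump that the distributional transform fills. *)
Definition cdf_right (x : R) : R := fine (cdf_of x).
Definition cdf_left (x : R) : R := fine (rho `]-oo, x[%classic).
Local Notation F := cdf_right.
Local Notation L := cdf_left.

Lemma cdf_ofE x : cdf_of x = (F x)%:E.
Proof. by rewrite fineK// fin_num_measure. Qed.

Let LE x : rho `]-oo, x[%classic = (L x)%:E.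
Proof. by rewrite fineK// fin_num_measure. Qed.

Let LF x y : x < y -> F x <= L y.
Proof.
move=> xy; rewrite -lee_fin -cdf_ofE -LE; apply: le_measure; rewrite ?inE//.
by move=> z /=; rewrite !in_itv/= => /le_lt_trans; apply.
Qed.

Let FL x : L x <= F x.
Proof.
rewrite -lee_fin -cdf_ofE -LE; apply: le_measure; rewrite ?inE//.
by move=> z /=; rewrite !in_itv/=; exact: ltW.
Qed.

Let F_nd x y : x <= y -> F x <= F y.
Proof. by rewrite le_eqVlt => /predU1P[-> //|/LF/le_trans]; apply; exact: FL. Qed.

Let L_nd x y : x <= y -> L x <= L y.
Proof. by rewrite le_eqVlt => /predU1P[-> //|/LF]; apply: le_trans; exact: FL. Qed.

Let F_jump x : rho [set x] = (F x - L x)%:E.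
Proof.
have -> : [set x] = `]-oo, x]%classic `\` `]-oo, x[%classic.
  apply/seteqP; split => y /=; rewrite !in_itv/=; first by move=> ->; rewrite lexx ltxx.
  by move=> [yx /negP]; rewrite -leNgt => xy; apply/eqP; rewrite eq_le yx.
rewrite measureD//= ?ltey_eq ?fin_num_measure// EFinB -cdf_ofE -LE.
congr (_ - rho _)%E; apply/seteqP; split => y /=; rewrite !in_itv/=; first by case.
by move=> yx; rewrite yx (ltW yx).
Qed.

Let cdf_of_cvgy : F n%:R @[n --> \oo] --> (1 : R).
Proof.
apply: fine_cvg; rewrite -(probability_setT rho).
have <- : \bigcup_n `]-oo, n%:R]%classic = [set: R].
  rewrite -subTset => x _; exists (Num.truncn x).+1 => //=.
  by rewrite in_itv/= ltW// Num.Theory.truncnS_gt.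
apply: nondecreasing_cvg_mu => //; first exact: bigcup_measurable.
move=> m n mn; apply/subsetPset => x /=; rewrite !in_itv/= => /le_trans; apply.
by rewrite ler_nat.
Qed.

Let cdf_of_cvgNy : F (- n%:R) @[n --> \oo] --> (0 : R).
Proof.
apply: fine_cvg; rewrite -[0%:E](measure0 rho).
have <- : \bigcap_n `]-oo, (- n%:R)]%classic = set0 :> set R.
  apply/seteqP; split => // x /(_ (Num.truncn (- x)).+1 I) /=.
  by rewrite in_itv/= lerNr leNgt Num.Theory.truncnS_gt.
apply: nonincreasing_cvg_mu => //.
- by rewrite ltey_eq fin_num_measure.
- exact: bigcapT_measurable.
move=> m n mn; apply/subsetPset => x /=; rewrite !in_itv/= => /le_trans; apply.
by rewrite lerN2 ler_nat.
Qed.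

Let F_right x : F (x + n.+1%:R^-1) @[n --> \oo] --> F x.
Proof.
apply: fine_cvg; rewrite -cdf_ofE /cdf_of (itvNycEbigcap false).
apply: nonincreasing_cvg_mu => //.
- by rewrite ltey_eq fin_num_measure.
- exact: bigcapT_measurable.
move=> m n mn; apply/subsetPset => y /=; rewrite !in_itv/= => /le_trans; apply.
by rewrite lerD2l lef_pV2 ?posrE// ler_nat.
Qed.

Let L_left x : F (x - n.+1%:R^-1) @[n --> \oo] --> L x.
Proof.
apply: fine_cvg; rewrite -LE.
have <- : \bigcup_n `]-oo, (x - n.+1%:R^-1)]%classic = `]-oo, x[%classic.
  apply/seteqP; split => y /=.
    by move=> [n _] /=; rewrite !in_itv/= => /le_lt_trans; apply; rewrite ltrBlDr ltrDl.
  rewrite in_itv/= => yx.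
  have [n ny] : exists n, n.+1%:R^-1 < x - y.
    have xy0 : 0 < x - y by rewrite subr_gt0.
    exists (Num.truncn (x - y)^-1).
    rewrite -[ltRHS]invrK ltf_pV2 ?posrE ?invr_gt0//.
    exact: Num.Theory.truncnS_gt.
  by exists n => //=; rewrite in_itv/= lerBrDr addrC -lerBrDr ltW.
apply: nondecreasing_cvg_mu => //; first exact: bigcup_measurable.
move=> m n mn; apply/subsetPset => y /=; rewrite !in_itv/= => /le_trans; apply.
by rewrite lerD2l lerN2 lef_pV2 ?posrE// ler_nat.
Qed.

Local Notation quant := (quantile cdf_of).

(** The distribution function being right-continuous with limits 0 and 1, the
    infimum that defines the quantile is attained. *)
Lemma quantile_le (s t : R) : 0 < s < 1 -> (quant s <= t) = (s <= F t).
Proof.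
move=> /andP[s0 s1].
have E0 : [set t | (s%:E <= cdf_of t)%E] !=set0.
  have [n _ /(_ n (leqnn n))] := cvgr_gt _ cdf_of_cvgy _ s1.
  by exists n%:R => /=; rewrite cdf_ofE lee_fin ltW.
have Elb : has_lbound [set t | (s%:E <= cdf_of t)%E].
  have [n _ /(_ n (leqnn n)) /= Fn] := cvgr_lt _ cdf_of_cvgNy _ s0.
  exists (- n%:R) => y /=; rewrite cdf_ofE lee_fin leNgt => sF.
  by rewrite leNgt; apply: contra sF => /ltW/F_nd/le_lt_trans; apply.
apply/idP/idP => [qt|sF]; last first.
  by apply: ge_inf => //=; rewrite cdf_ofE lee_fin.
have := @cvgr_to_ge _ _ _ _ _ _ s (@F_right t); apply.
apply: nearW => n.
have : inf [set t | (s%:E <= cdf_of t)%E] < t + n.+1%:R^-1.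
  by rewrite (le_lt_trans qt)// ltrDl.
move=> /inf_lt -/(_ E0)[y /=]; rewrite cdf_ofE lee_fin => sFy yt.
by rewrite (le_trans sFy)//; apply: F_nd; exact: ltW.
Qed.

Let quantile_left (s : R) : 0 < s < 1 -> L (quant s) <= s.
Proof.
move=> s01; have := @cvgr_to_le _ _ _ _ _ _ s (@L_left (quant s)); apply.
apply: nearW => n; rewrite leNgt; apply/negP => /ltW; rewrite -quantile_le//.
by rewrite leNgt ltrBlDr ltrDl invr_gt0 ltr0n.
Qed.

Let quantile_right (s : R) : 0 < s < 1 -> s <= F (quant s).
Proof. by move=> s01; rewrite -quantile_le. Qed.

(** The distributional transform: spread the mass of an atom [x] uniformly over
    the jump of the distribution function at [x]. *)
Definition dist_transform (x v : R) : R := L x + v * (F x - L x).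
Local Notation g := dist_transform.

Lemma measurable_dist_transform :
  measurable_fun setT (fun p : R * R => g p.1 p.2).
Proof.
have mF : measurable_fun setT F by exact: nondecreasing_measurable.
have mL : measurable_fun setT L by exact: nondecreasing_measurable.
apply: measurable_funD; first exact: measurableT_comp mL measurable_fst.
apply: measurable_funM; first exact: measurable_snd.
by apply: measurable_funB; apply: measurableT_comp measurable_fst.
Qed.

Local Notation m := (rho \x unif R)%E.

Let measurable_g (B : set R) : measurable B ->
  measurable [set p : R * R | B (g p.1 p.2)].
Proof.
by move=> mB; rewrite -[X in measurable X]setTI; exact: measurable_dist_transform.
Qed.

Let gF x v : v <= 1 -> g x v <= F x.
Proof.
move=> v1; rewrite /g -lerBrDl ler_piMl// subr_ge0; exact: FL.
Qed.

Let gL x v : 0 <= v -> L x <= g x v.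
Proof. by move=> v0; rewrite /g lerDl mulr_ge0// subr_ge0; exact: FL. Qed.

(* The level u lies in the jump at its quantile, at the fraction c. *)
Let split_level u : 0 < u < 1 -> exists c, [/\ 0 <= c <= 1,
  L (quant u) + c * (F (quant u) - L (quant u)) = u &
  forall v, g (quant u) v < u -> v < c].
Proof.
move=> u01; have := quantile_left u01; have := quantile_right u01.
set x := quant u => uF Lu; have jump0 : 0 <= F x - L x by rewrite subr_ge0.
exists ((u - L x) / (F x - L x)); have [j0|j0] := eqVneq (F x - L x) 0.
  rewrite j0 invr0 !mulr0 lexx ler01; split => //; first by lra.
  by move=> v; rewrite /g j0; lra.
have jp : 0 < F x - L x by rewrite lt_neqAle eq_sym j0.
split.
- by rewrite divr_ge0 ?ler_pdivrMr//=; lra.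
- by rewrite divfK//; lra.
- by move=> v; rewrite /g ltr_pdivlMr//; lra.
Qed.

(* For v at most 1, the transform is at most u strictly to the left of the
   u-quantile x, and on the part v <= c of the atom at x: by the choice of c this
   has mass u. *)
Let transform_lower u : 0 < u < 1 ->
  (u%:E <= m [set p : R * R | g p.1 p.2 <= u]%R)%E.
Proof.
move=> u01; have [c [c01 cE _]] := split_level u01.
set x := quant u in cE.
have -> : u%:E = m (`]-oo, x[%classic `*` `]-oo, 1]%classic `|`
                    [set x] `*` `]-oo, c]%classic).
  rewrite measureU//=; first last.
  - by apply/seteqP; split => -[y z]//= [[+ _] [yx _]]; rewrite yx in_itv/= ltxx.
  - exact: measurableX.
  - exact: measurableX.
  rewrite ![(_ \x _)%E _]product_probE// F_jump LE !unif_le clamp_gt1// clamp_id//.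
  by rewrite mule1 -EFinM -EFinD mulrC cE.
apply: le_measure; rewrite ?inE.
- by apply: measurableU; exact: measurableX.
- exact: (measurable_g (measurable_itv `]-oo, u])).
move=> [y v] /= [[]|[->]]; rewrite !in_itv/=.
  move=> yx v1; apply: (le_trans (gF _ v1)); apply: (le_trans (LF yx)).
  exact: quantile_left.
move=> vc; rewrite -[leRHS]cE /g lerD2l ler_wpM2r// subr_ge0; exact: FL.
Qed.

(* Apart from negative values of v, the transform can be less than u only
   strictly to the left of x, or on the part v < c of the atom at x. *)
Let transform_upper u : 0 < u < 1 ->
  (m [set p : R * R | g p.1 p.2 < u]%R <= u%:E)%E.
Proof.
move=> u01; have [c [c01 cE cP]] := split_level u01.
set x := quant u in cE.
have -> : u%:E = m (`]-oo, x[%classic `*` setT `|`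
                    ([set x] `*` `]-oo, c[%classic)) .
  rewrite measureU//=; first last.
  - by apply/seteqP; split => -[y z]//= [[+ _] [yx _]]; rewrite yx in_itv/= ltxx.
  - exact: measurableX.
  - exact: measurableX.
  rewrite ![(_ \x _)%E _]product_probE// F_jump LE unif_lt clamp_id//.
  by rewrite probability_setT mule1 -EFinM -EFinD mulrC cE.
have neg0 : m (setT `*` `]-oo, 0[%classic) = 0%E.
  by rewrite [LHS]product_probE// unif_lt clamp_lt0// mule0.
rewrite -[leRHS]adde0 -[X in (_ + X)%E]neg0.
apply: (le_trans _ (measureU2 _ _ _)); rewrite ?inE; first last.
- exact: measurableX.
- by apply: measurableU; exact: measurableX.
apply: le_measure; rewrite ?inE.
- exact: (measurable_g (measurable_itv `]-oo, u[)).
- by apply: measurableU; [apply: measurableU|]; exact: measurableX.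
move=> [y v] /= yvu; rewrite !in_itv/=.
have [v0|v0] := ltP v 0; first by right.
left; have [yx|yx|yx] := ltgtP y x; first by left.
  have := le_trans (quantile_right u01) (le_trans (LF yx) (gL _ v0)).
  by rewrite leNgt yvu.
by right; split => //; apply: cP; rewrite -/x -yx.
Qed.

Let transform_le a : m [set p : R * R | g p.1 p.2 <= a] = (clamp a)%:E.
Proof.
have mono a' b' : a' < b' -> (m [set p : R * R | g p.1 p.2 <= a']%R <=
                    m [set p : R * R | g p.1 p.2 < b']%R)%E.
  move=> ab; apply: le_measure; rewrite ?inE.
  - exact: (measurable_g (measurable_itv `]-oo, a'])).
  - exact: (measurable_g (measurable_itv `]-oo, b'[)).
  by move=> p /= /le_lt_trans; apply.
have mono' a' b' : a' <= b' -> (m [set p : R * R | g p.1 p.2 <= a']%R <=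
                    m [set p : R * R | g p.1 p.2 <= b']%R)%E.
  move=> ab; apply: le_measure; rewrite ?inE.
  - exact: (measurable_g (measurable_itv `]-oo, a'])).
  - exact: (measurable_g (measurable_itv `]-oo, b'])).
  by move=> p /= /le_trans; apply.
have up u : 0 < u < 1 -> a < u -> (m [set p : R * R | g p.1 p.2 <= a]%R <= u%:E)%E.
  by move=> u01 au; apply: (le_trans (mono _ _ au)); exact: transform_upper.
have lo u : 0 < u < 1 -> u <= a -> (u%:E <= m [set p : R * R | g p.1 p.2 <= a]%R)%E.
  by move=> u01 au; apply: (le_trans (transform_lower u01)); exact: mono'.
have m1 : (m [set p : R * R | g p.1 p.2 <= a]%R <= 1)%E.
  by apply: probability_le1; exact: (measurable_g (measurable_itv `]-oo, a])).
have m0 : (0 <= m [set p : R * R | g p.1 p.2 <= a]%R)%E by [].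
have mfin : m [set p : R * R | g p.1 p.2 <= a] \is a fin_num.
  by rewrite ge0_fin_numE// (le_lt_trans m1)// ltry.
move: m0 m1 up lo mfin; case: (m _) => // r.
rewrite !lee_fin => r0 r1 up lo _; congr EFin.
have {}up u : 0 < u < 1 -> a < u -> r <= u by move=> ? ?; rewrite -lee_fin up.
have {}lo u : 0 < u < 1 -> u <= a -> u <= r by move=> ? ?; rewrite -lee_fin lo.
have [a0|a0] := leP a 0.
  rewrite clamp_lt0//; apply/eqP; rewrite eq_le r0 andbT leNgt; apply/negP => rp.
  by have := up (r / 2) ltac:(lra) ltac:(lra); lra.
have [a1|a1] := leP 1 a.
  rewrite clamp_gt1//; apply/eqP; rewrite eq_le r1 /= leNgt; apply/negP => rp.
  by have := lo ((r + 1) / 2) ltac:(lra) ltac:(lra); lra.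
rewrite clamp_id; last by lra.
apply/eqP; rewrite eq_le (lo a) ?andbT; [|lra..].
rewrite leNgt; apply/negP => ar.
by have := up ((a + r) / 2) ltac:(lra) ltac:(lra); lra.
Qed.

(** [transform_lower] and [transform_upper] squeeze the distribution function
    of the transform between levels below and above its argument. *)
Lemma unif_dist_transform A : measurable A ->
  m [set p : R * R | A (g p.1 p.2)] = unif R A.
Proof.
apply: (@eq_law_pi _ _ _ _ _ m (unif R) (fun p => g p.1 p.2) (@rays R)).
- exact: measurable_dist_transform.
- exact: rays_gen.
- exact: raysI.
move=> _ [a ->]; rewrite [RHS]unif_le -transform_le.
by congr ((_ \x _)%E _); apply/seteqP; split => p /=; rewrite in_itv.
Qed.

End quantile_transform.

(** * The quantile function inverts the distributional transform *)

Lemma eq_prob_mod_null d (T : measurableType d) (R : realType)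
    (P : probability T R) (A B N : set T) :
  measurable A -> measurable B -> measurable N -> P N = 0%E ->
  (forall x, ~ N x -> A x <-> B x) -> P A = P B.
Proof.
move=> mA mB mN N0 AB.
rewrite [LHS](measureDI P mA mN) [RHS](measureDI P mB mN).
congr (P _ + _)%E.
  by apply/seteqP; split => x [Cx nNx]; split => //; apply/(AB x nNx).
have null_cap C : measurable C -> P (C `&` N) = 0%E.
  move=> mC; apply: (@subset_measure0 _ _ _ P (C `&` N) N) => //.
  exact: measurableI.
by transitivity (0%E : \bar R); [exact: null_cap|exact/esym/null_cap].
Qed.

Section clip.
Variable R : realType.

(** The value 1/2 outside the open unit interval is arbitrary: a uniform variable
    leaves that interval with probability 0. *)
Definition clip01 (x : R) : oitv01 R :=
  insubd (exist (fun x : R => 0 < x < 1) 2^-1 (half_in_oitv01 R)) x.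

Lemma clip01E x : oitv01_val (clip01 x) = if 0 < x < 1 then x else 2^-1.
Proof. by rewrite /oitv01_val /clip01 val_insubd. Qed.

Lemma oitv01_valP (s : oitv01 R) : 0 < oitv01_val s < 1.
Proof. exact: (valP (s : {x : R | 0 < x < 1})). Qed.

Lemma measurable_oitv01_val : measurable_fun setT (@oitv01_val R).
Proof. by move=> _ B mB; exists B. Qed.

Lemma measurable_to_oitv01 d (T : measurableType d) (f : T -> oitv01 R) :
  measurable_fun setT (fun t => oitv01_val (f t)) -> measurable_fun setT f.
Proof.
move=> mf _ _ [B mB <-]; rewrite !setTI -[X in measurable X]setTI.
exact: (mf measurableT B mB).
Qed.

Lemma measurable_clip01 : measurable_fun setT clip01.
Proof.
apply: measurable_to_oitv01.
rewrite (_ : (fun t => _) = (fun x => if 0 < x < 1 then x else 2^-1)); last first.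
  by apply/funext => x; rewrite clip01E.
have -> : (fun x : R => if 0 < x < 1 then x else 2^-1) =
    (fun x => if (0 < x) && (x < 1) then x else 2^-1) by [].
apply: measurable_fun_ifT; last exact: measurable_cst.
  apply: measurable_and; apply: measurable_fun_ltr; [|exact: measurable_id|exact: measurable_id|]; exact: measurable_cst.
exact: measurable_id.
Qed.

Lemma unif_oitv01 : unif R (~` [set x : R | 0 < x < 1]) = 0%E.
Proof.
have -> : [set x : R | 0 < x < 1] = `]0, 1[%classic.
  by apply/seteqP; split => x /=; rewrite in_itv.
rewrite probability_setC// [X in (_ - X)%E](@unif_itv _ _ 0 1)//.
- by rewrite subr0 subee.
- by move=> x; rewrite in_itv/=; lra.
- by move=> x; rewrite in_itv/=; lra.
Qed.

End clip.

Section quantile_of_transform.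
Variables (R : realType) (rho : probability R R).
Local Notation m := (rho \x unif R)%E.
Local Notation quant := (quantile (cdf_of rho)).

Definition unit_transform (p : R * R) : oitv01 R :=
  clip01 (dist_transform rho p.1 p.2).

Lemma measurable_unit_transform : measurable_fun setT unit_transform.
Proof.
apply: measurableT_comp; first exact: measurable_clip01.
exact: measurable_dist_transform.
Qed.

Let gN : set (R * R) :=
  [set p | (~` [set x : R | 0 < x < 1]) (dist_transform rho p.1 p.2)].

Let m01 : measurable (~` [set x : R | 0 < x < 1]).
Proof.
apply: measurableC; have -> : [set x : R | 0 < x < 1] = `]0, 1[%classic.
  by apply/seteqP; split => x /=; rewrite in_itv.
exact: measurable_itv.
Qed.

Let gN0 : m gN = 0%E.
Proof. by rewrite unif_dist_transform ?unif_oitv01. Qed.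

Let mgN : measurable gN.
Proof.
by rewrite -[X in measurable X]setTI; exact: (measurable_dist_transform rho measurableT m01).
Qed.

Let measurable_unit_pre A : measurable A ->
  measurable [set p | A (oitv01_val (unit_transform p))].
Proof.
move=> mA; rewrite -[X in measurable X]setTI.
apply: (measurableT_comp (@measurable_oitv01_val R) measurable_unit_transform) => //.
Qed.

Lemma unif_unit_transform A : measurable A ->
  m [set p | A (oitv01_val (unit_transform p))] = unif R A.
Proof.
move=> mA; rewrite -(unif_dist_transform rho mA).
apply: (@eq_prob_mod_null _ _ _ m _ _ gN) => //.
- exact: measurable_unit_pre.
- by rewrite -[X in measurable X]setTI; exact: (measurable_dist_transform rho measurableT mA).
move=> p; rewrite /gN /= /unit_transform clip01E => /contrapT ->.
by [].
Qed.

Lemma measurable_quantile :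
  measurable_fun setT (fun s : oitv01 R => quant (oitv01_val s)).
Proof.
apply: (@measurability _ _ _ _ _ _ (@rays R)); first exact: rays_gen.
move=> _ [_ [a ->] <-]; rewrite setTI.
have -> : (fun s : oitv01 R => quant (oitv01_val s)) @^-1` `]-oo, a]%classic =
    (@oitv01_val R) @^-1` `]-oo, cdf_right rho a]%classic.
  apply/seteqP; split => s /=; rewrite !in_itv/= quantile_le//; exact: oitv01_valP.
by rewrite -[X in measurable X]setTI; exact: measurable_oitv01_val.
Qed.

(** The quantile [Y] of the transform does not exceed the original variable, as
    the transform stays below the distribution function there, and it has the
    same law. If the two differed with positive probability, some rational would
    separate them with positive probability, and the laws would differ. *)
Lemma quantile_unit_transform :
  {ae m, forall p, quant (oitv01_val (unit_transform p)) = p.1}.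
Proof.
pose Y (p : R * R) := quant (oitv01_val (unit_transform p)).
have mY : measurable_fun setT Y.
  exact: (measurableT_comp measurable_quantile measurable_unit_transform).
have Y_le r : [set p | Y p <= r] =
    [set p | `]-oo, cdf_right rho r]%classic (oitv01_val (unit_transform p))].
  apply/seteqP; split => p /=; rewrite in_itv/= /Y quantile_le//; exact: oitv01_valP.
have mYle r : measurable [set p | Y p <= r].
  by rewrite Y_le; exact: (measurable_unit_pre (measurable_itv _)).
have mXle r : measurable [set p : R * R | p.1 <= r].
  rewrite (_ : [set p : R * R | p.1 <= r] = `]-oo, r]%classic `*` setT).
    exact: measurableX.
  by apply/seteqP; split => p /=; rewrite in_itv//= => -[].
pose N := gN `|` setT `*` ~` `]-oo, 1]%classic.
have mN : measurable N.
  by apply: measurableU => //; apply: measurableX => //; exact: measurableC.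
have N0 : m N = 0%E.
  apply: null_set_setU => //; first by apply: measurableX => //; exact: measurableC.
  rewrite [LHS]product_probE//; last exact: measurableC.
  by rewrite probability_setC// unif_le clamp_gt1// subee// mule0.
have YX p : ~ N p -> Y p <= p.1.
  move=> /not_orP[/contrapT g01 nv].
  have v1 : p.2 <= 1.
    rewrite leNgt; apply/negP => v1; apply: nv; split => //=.
    by rewrite in_itv/=; apply/negP; rewrite -ltNge.
  rewrite /Y quantile_le; last exact: oitv01_valP.
  rewrite /unit_transform clip01E g01 /dist_transform -lerBrDl ler_piMl// subr_ge0.
  rewrite /cdf_left /cdf_right fine_le ?fin_num_measure//.
  by apply: le_measure; rewrite ?inE// => z /=; rewrite !in_itv/=; exact: ltW.
have mfin A : measurable A -> (m A < +oo)%E.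
  by move=> mA; apply: (le_lt_trans (@probability_le1 _ _ _ m _ mA)); rewrite ltry.
have cross r : m ([set p | Y p <= r] `\` [set p : R * R | p.1 <= r]) = 0%E.
  rewrite [LHS](measureD (mYle r) (mXle r) (mfin _ (mYle r))).
  rewrite [X in (_ - X)%E](@eq_prob_mod_null _ _ _ m _ [set p : R * R | p.1 <= r] N)//; first last.
  - by move=> p /YX Yp; split => [[]//|/= pr]; split => //=; exact: le_trans pr.
  - exact: measurableI.
  rewrite Y_le [X in (X - _)%E]unif_unit_transform// [X in (X - _)%E]unif_le clamp_id; last first.
    rewrite /cdf_right fine_ge0//=.
    by rewrite -lee_fin fineK ?fin_num_measure//; exact: probability_le1.
  rewrite (_ : [set p : R * R | p.1 <= r] = `]-oo, r]%classic `*` setT); last first.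
    by apply/seteqP; split => p /=; rewrite in_itv//= => -[].
  rewrite [X in (_ - X)%E]product_probE// probability_setT mule1 /cdf_right fineK ?fin_num_measure//.
  by rewrite subee// fin_num_measure.
have [e eP] : exists e : nat -> rat, forall q, exists n, e n = q.
  by exists (fun n => odflt 0 (unpickle n)) => q; exists (pickle q); rewrite pickleK.
pose E n := [set p | Y p <= ratr (e n)] `\` [set p : R * R | p.1 <= ratr (e n)].
have : m.-negligible (N `|` \bigcup_n E n).
  apply: negligibleU; first by apply/negligibleP.
  apply: negligible_bigcup => n.
  by apply/negligibleP; [exact: measurableD|exact: cross].
apply: negligibleS => p /= Yp.
have [Np|nNp] := pselect (N p); [by left|right].
have := YX p nNp; rewrite le_eqVlt => /predU1P[//|].
move=> /rat_in_itvoo[q]; rewrite in_itv/= => /andP[Yq qX].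
have [n en] := eP q; exists n; first exact: I.
by rewrite /E en; split; [exact: ltW|apply/negP; rewrite -ltNge].
Qed.

End quantile_of_transform.

(** * Coding a process with independent noise *)

Section product_probability.
Context d1 d2 (T1 : measurableType d1) (T2 : measurableType d2) (R : realType).
Variables (P : probability T1 R) (Q : probability T2 R).
Local Open Scope ereal_scope.

Definition prod_prob : probability (T1 * T2)%type R := (P \x Q).

Lemma prod_probE A B : measurable A -> measurable B ->
  prod_prob (A `*` B) = P A * Q B.
Proof. exact: product_probE. Qed.

Lemma xsecE (C : set (T1 * T2)) x : [set y | C (x, y)] = xsection C x.
Proof. by apply/seteqP; split => y; rewrite /xsection/= inE. Qed.

Lemma ysecE (C : set (T1 * T2)) y : [set x | C (x, y)] = ysection C y.
Proof. by apply/seteqP; split => x; rewrite /ysection/= inE. Qed.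

Lemma measurable_xsec (C : set (T1 * T2)) x : measurable C ->
  measurable [set y | C (x, y)].
Proof. by rewrite xsecE; exact: measurable_xsection. Qed.

Lemma measurable_ysec (C : set (T1 * T2)) y : measurable C ->
  measurable [set x | C (x, y)].
Proof. by rewrite ysecE; exact: measurable_ysection. Qed.

Lemma measurable_fun_xsec (C : set (T1 * T2)) : measurable C ->
  measurable_fun setT (fun x => Q [set y | C (x, y)]).
Proof.
move=> mC; under eq_fun do rewrite xsecE.
exact: (measurable_fun_xsection Q mC).
Qed.

Lemma measurable_fun_ysec (C : set (T1 * T2)) : measurable C ->
  measurable_fun setT (fun y => P [set x | C (x, y)]).
Proof.
move=> mC; under eq_fun do rewrite ysecE.
exact: (measurable_fun_ysection P mC).
Qed.

Lemma prod_prob_xsec (C : set (T1 * T2)) :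
  prod_prob C = \int[P]_x Q [set y | C (x, y)].
Proof. by apply: eq_integral => x _; rewrite xsecE. Qed.

Lemma prod_prob_ysec (C : set (T1 * T2)) : measurable C ->
  prod_prob C = \int[Q]_y P [set x | C (x, y)].
Proof.
move=> mC.
have -> : prod_prob C = (P \x^ Q) C.
  by apply: product_measure_unique => // A B mA mB; exact: product_measure2E.
by apply: eq_integral => y _; rewrite ysecE.
Qed.

End product_probability.

Section integral_bounds.
Context d (T : measurableType d) (R : realType) (P : probability T R).
Local Open Scope ereal_scope.

Lemma integrable_le1 (c : T -> \bar R) : measurable_fun setT c ->
  (forall x, 0 <= c x <= 1) -> P.-integrable setT c.
Proof.
move=> mc c01; apply: (@le_integrable _ _ _ P setT measurableT c (cst 1)) => //.
  by move=> x _; have /andP[? ?] := c01 x; rewrite gee0_abs// gee0_abs.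
exact: (@finite_measure_integrable_cst _ _ _ P setT 1%R).
Qed.

Lemma integral_dist_le (c e delta : T -> \bar R) :
  measurable_fun setT c -> measurable_fun setT e -> measurable_fun setT delta ->
  (forall x, 0 <= c x <= 1) -> (forall x, 0 <= e x <= 1) ->
  (forall x, `|c x - e x| <= delta x) ->
  `|\int[P]_x c x - \int[P]_x e x| <= \int[P]_x delta x.
Proof.
move=> mc me md c01 e01 ced.
rewrite -integralB//; [|exact: integrable_le1..].
have mce : measurable_fun setT (c \- e) by exact: emeasurable_funB.
apply: (le_trans (le_abse_integral P measurableT mce)).
by apply: ge0_le_integral => //; exact: measurableT_comp.
Qed.

Lemma integral_cst_prob (k : \bar R) : \int[P]_x k = k.
Proof. by rewrite integral_cst//= probability_setT mule1. Qed.

(** The integral of a nonnegative function is the supremum over the simple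
    functions below it, so it is monotone even for functions such as the suprema
    over uncountably many events in [beta_coef], which may fail to be
    measurable. *)
Lemma ge0_le_lower_integral (f h : T -> \bar R) :
  (forall x, 0 <= f x) -> (forall x, f x <= h x) ->
  \int[P]_x f x <= \int[P]_x h x.
Proof.
move=> f0 fh; have h0 x : 0 <= h x by exact: le_trans (fh x).
rewrite !ge0_integralTE//; apply: le_ereal_sup => _ [s sf <-].
by exists s => // x; exact: le_trans (fh x).
Qed.

End integral_bounds.

Section coding.
Context (R : realType) d1 d2 d3 (E1 : measurableType d1) (E2 : measurableType d2)
  (E3 : measurableType d3).
Variables (nu : probability (zseq E1) R) (tau : probability (zseq E2) R)
  (q2 : probability E2 R) (g : E1 * E2 -> E3) (mu : probability (zseq E3) R).

(** The output at time [t] depends on the inputs at time [t] only; this keeps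
    past and future apart, and makes the code commute with the shift. *)
Definition code (p : zseq E1 * zseq E2) : zseq E3 := fun t => g (p.1 t, p.2 t).

Hypotheses (iid_tau : iid_law q2 tau) (mg : measurable_fun setT g).
Hypothesis muE : forall C, measurable C -> mu C = prod_prob nu tau (code @^-1` C).

Lemma measurable_code : measurable_fun setT code.
Proof.
apply: measurable_zseq => t; apply: measurableT_comp => //.
apply: measurable_fun_pair.
  exact: (measurableT_comp (measurable_coord t) measurable_fst).
exact: (measurableT_comp (measurable_coord t) measurable_snd).
Qed.

Lemma measurable_code_pre C : measurable C -> measurable (code @^-1` C).
Proof. by move=> mC; rewrite -[X in measurable X]setTI; exact: (measurable_code measurableT mC). Qed.

(** For a frozen noise the code is a time-by-time recoding of the process, so
    that events of the past and of the future keep their nature. *)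
Definition code_sec (C : set (zseq E3)) (z : zseq E2) : set (zseq E1) :=
  [set y | C (code (y, z))].

Lemma coord_sigma_sec I C z : coord_sigma I C -> coord_sigma I (code_sec C z).
Proof.
apply: coord_sigma_preimage; first exact: coord_sigma_algebra.
move=> t B It mB.
apply: (@coord_sigma_eval _ _ I t [set e | B (g (e, z t))] It).
rewrite -[X in measurable X]setTI.
by apply: (measurableT_comp mg (pair2_measurable (z t))).
Qed.

Lemma measurable_sec C z : measurable C -> measurable (code_sec C z).
Proof. exact: coord_sigma_sec. Qed.

Lemma code_sec_sat I C z z' : coord_sigma I C -> (forall t, I t -> z t = z' t) ->
  code_sec C z = code_sec C z'.
Proof.
move=> IC zz'; apply/funext => y; rewrite /code_sec/=.
by apply: (coord_sigma_sat IC) => t It; rewrite /code /= zz'.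
Qed.

Lemma code_sec_splice I J C z z' : J `<=` I -> coord_sigma J C ->
  code_sec C (splice I z z') = code_sec C z.
Proof.
move=> JI JC; apply: (code_sec_sat JC) => t /JI It.
by rewrite /splice; case: asboolP.
Qed.

Lemma code_sec_spliceC I J C z z' : J `<=` ~` I -> coord_sigma J C ->
  code_sec C (splice I z z') = code_sec C z'.
Proof.
move=> JI JC; apply: (code_sec_sat JC) => t /JI It.
by rewrite /splice; case: asboolP.
Qed.

Lemma code_secI A B z : code_sec (A `&` B) z = code_sec A z `&` code_sec B z.
Proof. by []. Qed.

Lemma measurable_fun_sec C : measurable C ->
  measurable_fun setT (fun z => nu (code_sec C z)).
Proof. by move=> /measurable_code_pre mC; exact: (measurable_fun_ysec nu mC). Qed.

Local Open Scope ereal_scope.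

Lemma mu_sec C : measurable C -> mu C = \int[tau]_z nu (code_sec C z).
Proof.
by move=> mC; rewrite muE// prod_prob_ysec//; exact: measurable_code_pre.
Qed.

(** The spliced noise has the law of the noise, by [iid_splice]. *)
Lemma tau_splice I (K : zseq E2 -> \bar R) : measurable_fun setT K ->
  (forall z, 0 <= K z) ->
  \int[tau]_z K z = \int[tau]_z \int[tau]_z' K (splice I z z').
Proof.
move=> mK K0.
have mS := @measurable_splice _ E2 I.
have mKS : measurable_fun setT (fun p : zseq E2 * zseq E2 => K (splice I p.1 p.2)).
  exact: measurableT_comp mS.
have lawS A : measurable A -> distribution (prod_prob tau tau) (to_mfun mS) A = tau A.
  by move=> mA; rewrite -(iid_splice iid_tau I mA).
transitivity (\int[distribution (prod_prob tau tau) (to_mfun mS)]_z K z).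
  by apply: eq_measure_integral => A mA _; apply/esym; exact: lawS.
rewrite ge0_integral_distribution//.
exact: (fubini_tonelli1 (m1 := tau) (m2 := tau) _ mKS).
Qed.

(** The two sections read disjoint parts of the noise, and may as well be given
    two independent noises; the double integral then factors. *)
Lemma mu_mul I A B : coord_sigma I A -> coord_sigma (~` I) B ->
  mu A * mu B = \int[tau]_z (nu (code_sec A z) * nu (code_sec B z)).
Proof.
move=> IA IB.
have mA := coord_sigma_measurable IA; have mB := coord_sigma_measurable IB.
have mfA := measurable_fun_sec mA; have mfB := measurable_fun_sec mB.
rewrite (@tau_splice I); first last.
- by move=> z; exact: mule_ge0.
- exact: emeasurable_funM.
transitivity (\int[tau]_z \int[tau]_z' (nu (code_sec A z) * nu (code_sec B z'))).
  rewrite (mu_sec mA) (mu_sec mB) -ge0_integralZr//; last exact: integral_ge0.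
  by apply: eq_integral => z _; rewrite ge0_integralZl.
apply: eq_integral => z _; apply: eq_integral => z' _.
by rewrite (code_sec_splice _ _ _ IA)// (code_sec_spliceC _ _ _ IB).
Qed.

(** By [mu_mul], the dependence between [A] and [B] is the average over the
    noise of the dependence between their sections. *)
Lemma sec_prob_bound (delta : zseq E2 -> \bar R) I A B :
  coord_sigma I A -> coord_sigma (~` I) B -> measurable_fun setT delta ->
  (forall z, `|nu (code_sec A z `&` code_sec B z) -
               nu (code_sec A z) * nu (code_sec B z)| <= delta z) ->
  `|mu (A `&` B) - mu A * mu B| <= \int[tau]_z delta z.
Proof.
move=> IA IB md bound.
have mA := coord_sigma_measurable IA; have mB := coord_sigma_measurable IB.
have mAB : measurable (A `&` B) by exact: measurableI.
rewrite (mu_mul IA IB) mu_sec//; apply: integral_dist_le => //.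
- exact: (measurable_fun_sec mAB).
- exact: (emeasurable_funM (measurable_fun_sec mA) (measurable_fun_sec mB)).
- by move=> z; rewrite measure_ge0 probability_le1//; exact: measurable_sec.
- move=> z; rewrite mule_ge0//= -[leRHS]mule1 lee_pmul//.
  + by rewrite probability_le1//; exact: measurable_sec.
  + by rewrite probability_le1//; exact: measurable_sec.
Qed.

End coding.

(** * Strong and uniform mixing rates of a code *)

Section past_future.
Context d (E : measurableType d).

Lemma past_sub_compl n : (0 < n)%N -> [set t : int | n%:Z <= t] `<=` ~` [set t | t <= 0].
Proof. by move=> n0 t /= nt t0; have := le_trans nt t0; case: n n0 {nt}. Qed.

Lemma future_compl_past n (B : set (zseq E)) : (0 < n)%N ->
  future n B -> coord_sigma (~` [set t | t <= 0]) B.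
Proof. by move=> n0; apply: sub_coord_sigma; exact: past_sub_compl. Qed.

End past_future.

Section rates.
Context (R : realType) d1 d2 d3 (E1 : measurableType d1) (E2 : measurableType d2)
  (E3 : measurableType d3).
Variables (nu : probability (zseq E1) R) (tau : probability (zseq E2) R)
  (q2 : probability E2 R) (g : E1 * E2 -> E3) (mu : probability (zseq E3) R)
  (dec : E3 -> E1).
Local Notation code := (code g).
Local Notation sec := (code_sec g).

Definition decode (u : zseq E3) : zseq E1 := fun t => dec (u t).

Hypotheses (iid_tau : iid_law q2 tau) (mg : measurable_fun setT g).
Hypothesis muE : forall C, measurable C -> mu C = prod_prob nu tau (code @^-1` C).
Hypothesis mdec : measurable_fun setT dec.
Hypothesis decK : {ae prod_prob nu tau, forall p, decode (code p) = p.1}.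

Lemma coord_sigma_decode I C : coord_sigma I C -> coord_sigma I (decode @^-1` C).
Proof.
apply: coord_sigma_preimage; first exact: coord_sigma_algebra.
move=> t B It mB; apply: (@coord_sigma_eval _ _ I t (dec @^-1` B) It).
by rewrite -[X in measurable X]setTI; exact: mdec.
Qed.

Lemma measurable_decode : measurable_fun setT decode.
Proof. by move=> _ C mC; rewrite setTI; exact: coord_sigma_decode. Qed.

Lemma decode_law C : measurable C -> mu (decode @^-1` C) = nu C.
Proof.
move=> mC; have mdC : measurable (decode @^-1` C) by exact: coord_sigma_decode.
have [N [mN N0 decN]] := decK.
transitivity (prod_prob nu tau (C `*` setT)).
  rewrite muE//; apply: (@eq_prob_mod_null _ _ _ (prod_prob nu tau) _ _ N) => //.
  - exact: measurable_code_pre.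
  - exact: measurableX.
  move=> p nNp; rewrite /preimage /=.
  have -> : decode (code p) = p.1 by apply: contrapT => /decN.
  by split => [Cp|[]].
by rewrite prod_probE// [X in (_ * X)%E]probability_setT mule1.
Qed.

Local Open Scope ereal_scope.

Lemma decode_lawI A B : measurable A -> measurable B ->
  mu (decode @^-1` A `&` decode @^-1` B) = nu (A `&` B).
Proof. by move=> mA mB; rewrite -preimage_setI decode_law//; exact: measurableI. Qed.

(** Conditioning on the noise bounds the coefficient of the code by that of the
    process; conversely every event of the past or future of the process is,
    through [decode], one of the code with the same probability. *)
Lemma alpha_coef_code n : (0 < n)%N -> alpha_coef mu n = alpha_coef nu n.
Proof.
move=> n0; apply/eqP; rewrite eq_le; apply/andP; split.
  apply: ge_ereal_sup => _ [A pA [B fB <-]].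
  rewrite -[leRHS](integral_cst_prob tau).
  apply: (sec_prob_bound iid_tau mg muE pA (future_compl_past n0 fB)) => // z.
  apply: ereal_sup_ubound; exists (sec A z); first exact: coord_sigma_sec.
  by exists (sec B z); first exact: coord_sigma_sec.
apply: ereal_sup_le => _ [A pA [B fB <-]].
exists (decode @^-1` A); first exact: coord_sigma_decode.
exists (decode @^-1` B); first exact: coord_sigma_decode.
have mA := coord_sigma_measurable pA; have mB := coord_sigma_measurable fB.
by rewrite decode_lawI// !decode_law.
Qed.

(* Clears the denominator in the conditional probabilities defining phi. *)
Let le_div (x a b : \bar R) (f : R) : x \is a fin_num -> a \is a fin_num ->
  b \is a fin_num -> 0 < a ->
  (`|x / a - b| <= f%:E) = (`|x - a * b| <= f%:E * a).
Proof.
move=> /fineK <- /fineK <- /fineK <-.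
move: (fine x) (fine a) (fine b) => {}x {}a {}b.
rewrite lte_fin => a0; rewrite inver gt_eqF//.
rewrite -!EFinM -!EFinB !abse_EFin !lee_fin.
rewrite (_ : (x - a * b = (x / a - b) * a)%R); last first.
  by rewrite mulrBl divfK ?gt_eqF// mulrC.
by rewrite normrM (gtr0_norm a0) ler_pM2r.
Qed.

(** As for [alpha_coef_code], with the bound [f] times the probability of the
    past event, which is linear in that event and hence averages over the noise;
    sections of probability 0 satisfy it trivially. *)
Lemma phi_coef_code n f : (0 < n)%N -> phi_coef nu n = f%:E -> phi_coef mu n = f%:E.
Proof.
move=> n0 phiE.
have mE C I : @coord_sigma _ E1 I C -> nu C \is a fin_num.
  by move=> /coord_sigma_measurable mC; exact: fin_num_measure.
have mE3 C I : @coord_sigma _ E3 I C -> mu C \is a fin_num.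
  by move=> /coord_sigma_measurable mC; exact: fin_num_measure.
have f0 : 0 <= f%:E.
  rewrite -phiE; apply: le_ereal_sup_tmp.
  exists `|nu (setT `&` setT) / nu setT - nu setT|; last exact: abse_ge0.
  exists setT; first by split; [exact: coord_sigmaT|rewrite probability_setT].
  by exists setT => //; exact: coord_sigmaT.
apply/eqP; rewrite eq_le; apply/andP; split.
  apply: ge_ereal_sup => _ [A [pA A0] [B fB <-]].
  have mA := coord_sigma_measurable pA; have mB := coord_sigma_measurable fB.
  rewrite le_div ?fin_num_measure//; last exact: measurableI.
  rewrite (mu_sec mg muE mA) -ge0_integralZl//; last exact: (measurable_fun_sec nu mg mA).
  rewrite -(mu_sec mg muE mA).
  apply: (sec_prob_bound iid_tau mg muE pA (future_compl_past n0 fB)).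
    by apply: emeasurable_funM => //; exact: (measurable_fun_sec nu mg mA).
  move=> z; have pAz := coord_sigma_sec mg z pA; have fBz := coord_sigma_sec mg z fB.
  have mAz := coord_sigma_measurable pAz; have mBz := coord_sigma_measurable fBz.
  have [Az0|Az0] := eqVneq (nu (sec A z)) 0.
    rewrite Az0 mul0e mule0 sube0.
    rewrite (@subset_measure0 _ _ _ nu (sec A z `&` sec B z) (sec A z))// ?abse0//.
    exact: measurableI.
  rewrite -le_div ?fin_num_measure//; first last.
  - by rewrite lt_neqAle eq_sym Az0 measure_ge0.
  - exact: measurableI.
  rewrite -phiE; apply: ereal_sup_ubound; exists (sec A z).
    by split => //; rewrite lt_neqAle eq_sym Az0 measure_ge0.
  by exists (sec B z).
rewrite -phiE; apply: ereal_sup_le => _ [A [pA A0] [B fB <-]].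
have mA := coord_sigma_measurable pA; have mB := coord_sigma_measurable fB.
exists (decode @^-1` A).
  by split; [exact: coord_sigma_decode|rewrite /= decode_law].
exists (decode @^-1` B); first exact: coord_sigma_decode.
by rewrite decode_lawI// !decode_law.
Qed.

End rates.

(** * Asymptotically negligible sequences of set functions *)

Section null_ideals.
Variable R : realType.

(** An abstract notion of negligible sequence, which treats mixing (convergence
    to 0) and weak mixing (Cesaro convergence to 0 of the absolute values) at
    once. The last clause is closure under uniform approximation. *)
Definition null_ideal (Nul : (nat -> R) -> Prop) : Prop :=
  [/\ forall u v, Nul u -> Nul v -> Nul (fun n => u n + v n),
      forall c u, Nul u -> Nul (fun n => c * u n),
      forall u, u n @[n --> \oo] --> (0 : R) -> Nul u &
      forall v, (forall e, 0 < e -> exists2 u, Nul u &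
                   forall n, `|v n - u n| <= e) -> Nul v].

Definition cvg_null (u : nat -> R) : Prop := u n @[n --> \oo] --> (0 : R).

Definition cesaro_abs (u : nat -> R) (n : nat) : R := n%:R^-1 * \sum_(i < n) `|u i|.

Definition cesaro_null (u : nat -> R) : Prop := cvg_null (cesaro_abs u).

Lemma cvg_null_ideal : null_ideal cvg_null.
Proof.
split.
- by move=> u v u0 v0; rewrite /cvg_null -[0](addr0 (0 : R)); exact: cvgD.
- by move=> c u u0; rewrite /cvg_null -(mulr0 c); exact: cvgMr.
- by [].
- move=> v vu; apply/cvgr0Pnorm_le => e e0.
  have [u u0 uv] := vu (e / 2) ltac:(lra).
  have e20 : 0 < e / 2 by lra.
  move/cvgr0Pnorm_le : u0 => /(_ _ e20); apply: filterS => n un.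
  rewrite -[v n](subrK (u n)); apply: (le_trans (ler_normD _ _)).
  by have := uv n; lra.
Qed.

Lemma cesaro_abs_ge0 u n : 0 <= cesaro_abs u n.
Proof. by rewrite mulr_ge0// ?invr_ge0// sumr_ge0. Qed.

Lemma cesaro_null_ideal : null_ideal cesaro_null.
Proof.
split.
- move=> u v u0 v0.
  have uv0 : cesaro_abs u n + cesaro_abs v n @[n --> \oo] --> (0 : R).
    by rewrite -[0](addr0 (0 : R)); exact: cvgD.
  have sq : \forall n \near \oo,
      0 <= cesaro_abs (fun n => u n + v n) n <= cesaro_abs u n + cesaro_abs v n.
    apply: nearW => n; rewrite cesaro_abs_ge0/= -mulrDr ler_wpM2l ?invr_ge0//.
    by rewrite -big_split/= ler_sum// => i _; exact: ler_normD.
  exact: (squeeze_cvgr sq (cvg_cst (0 : R)) uv0).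
- move=> c u u0; rewrite /cesaro_null /cvg_null -(mulr0 `|c|).
  rewrite (_ : cesaro_abs _ = (fun n => `|c| * cesaro_abs u n)); first exact: cvgMr.
  apply/funext => n; rewrite /cesaro_abs mulrCA; congr (_ * _).
  by rewrite mulr_sumr; apply: eq_bigr => i _; rewrite normrM.
- move=> u u0; rewrite /cesaro_null /cvg_null -cvg_shiftS.
  have u0' : `|u n| @[n --> \oo] --> (0 : R) by rewrite -(normr0 R); exact: cvg_norm.
  have := cesaro u0'; apply: cvg_trans; apply: near_eq_cvg; apply: nearW => n.
  by rewrite /cesaro_abs /arithmetic_mean /= /series /= big_mkord.
- move=> v vu; apply/cvgr0Pnorm_le => e e0.
  have [u u0 uv] := vu (e / 2) ltac:(lra).
  have e20 : 0 < e / 2 by lra.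
  move/cvgr0Pnorm_le : u0 => /(_ _ e20); apply: filterS => n.
  rewrite !ger0_norm ?cesaro_abs_ge0// => un.
  have : cesaro_abs v n <= cesaro_abs u n + e / 2; last by lra.
  rewrite /cesaro_abs; have [->|n0] := posnP n.
    by rewrite invr0 !mul0r add0r ltW.
  have n0' : 0 < n%:R :> R by rewrite ltr0n.
  rewrite mulrC ler_pdivrMr// mulrDl mulrAC mulVf ?gt_eqF// mul1r.
  have -> : e / 2 * n%:R = \sum_(i < n) (e / 2) by rewrite sumr_const card_ord mulr_natr.
  rewrite -big_split/= ler_sum// => i _.
  have := ler_normD (u i) (v i - u i); rewrite addrCA subrr addr0.
  by have := uv i; lra.
Qed.

End null_ideals.

Section null_dynkin.
Context d (T : measurableType d) (R : realType) (P : probability T R).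
Variables (Nul : (nat -> R) -> Prop) (D : nat -> set T -> R) (G : set (set T)).
Hypothesis idealN : null_ideal Nul.
Hypothesis DU : forall n A B, measurable A -> measurable B -> A `&` B = set0 ->
  D n (A `|` B) = D n A + D n B.
Hypothesis D_le : forall n A, measurable A -> `|D n A| <= fine (P A).
Hypotheses (gG : @measurable _ T = <<s G >>) (GI : setI_closed G) (GT : G setT).
Hypothesis DG : forall A, G A -> Nul (D ^~ A).

(** Dynkin's argument. For a countable disjoint union, the domination by a
    probability makes the approximation by finite unions uniform in [n]. *)
Lemma null_dynkin A : measurable A -> Nul (D ^~ A).
Proof.
have [Nadd Nscale Ncvg Nunif] := idealN.
have Nsub u v : Nul u -> Nul v -> Nul (fun n => u n - v n).
  move=> Nu Nv; have := Nadd _ _ Nu (Nscale (-1) _ Nv).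
  by congr Nul; apply/funext => n; rewrite mulN1r.
have D0 n : D n set0 = 0.
  have := DU n measurable0 measurable0 (set0I _); rewrite set0U.
  by move/eqP; rewrite -subr_eq subrr eq_sym => /eqP.
have N0 : Nul (D ^~ set0) by apply: Ncvg; under eq_fun do rewrite D0; exact: cvg_cst.
rewrite gG; apply: (@dynkin_induction _ _ G (fun A => Nul (D ^~ A))) => //.
- exact: DG.
- move=> S mS NS; have := Nsub _ _ (DG GT) NS; congr Nul; apply/funext => n.
  have := DU n mS (measurableC mS) (setICr S); rewrite setUCr => ->.
  by rewrite addrC addKr.
move=> F mF tF NF.
pose B k := \big[setU/set0]_(i < k) F i.
have mB k : measurable (B k) by apply: bigsetU_measurable => i _; exact: mF.
have mU : measurable (\bigcup_k F k) by exact: bigcupT_measurable.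
have NB k : Nul (D ^~ (B k)).
  elim: k => [|k IH]; first by rewrite /B big_ord0.
  have := Nadd _ _ IH (NF k); congr Nul; apply/funext => n.
  rewrite /B big_ord_recr/= DU//; first exact: mB.
  by apply: (@trivIset_bigsetUI _ predT) => //; rewrite /predT /= trueE.
have BU k : B k `<=` \bigcup_k F k.
  by rewrite /B -bigcup_mkord => x [i _ Fx]; exists i.
have cvgB : fine (P (\bigcup_k F k `\` B k.+1)) @[k --> \oo] --> (0 : R).
  apply: fine_cvg; rewrite -[0%:E](measure0 P).
  have <- : \bigcap_k (\bigcup_k F k `\` B k.+1) = set0.
    apply/seteqP; split => // x cx.
    have [[k _ Fx] _] := cx 0%N I.
    by have [_] := cx k I; apply; rewrite /B big_ord_recr/=; right.
  apply: nonincreasing_cvg_mu.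
  - by rewrite ltey_eq fin_num_measure//; exact: measurableD.
  - by move=> k; exact: measurableD.
  - by apply: bigcapT_measurable => k; exact: measurableD.
  - by move=> m n mn; apply/subsetPset; apply: setDS; exact: subset_bigsetU.
apply: Nunif => e e0.
have [k _ /(_ k (leqnn k)) /= Pk] := (cvgr0Pnorm_le _).1 cvgB e e0.
exists (D ^~ (B k.+1)) => // n.
have mUB : measurable (\bigcup_k F k `\` B k.+1) by exact: measurableD.
have : \bigcup_k F k = B k.+1 `|` (\bigcup_k F k `\` B k.+1).
  by rewrite setDUK.
move=> {1}->; rewrite DU//; last by rewrite setDIK.
rewrite addrAC subrr add0r; apply: (le_trans (D_le n mUB)).
by apply: le_trans Pk; exact: ler_norm.
Qed.

End null_dynkin.

(** * Correlations in the product with the noise *)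

Section shifted_product.
Context (R : realType) d1 d2 (E1 : measurableType d1) (E2 : measurableType d2).
Variables (nu : probability (zseq E1) R) (tau : probability (zseq E2) R)
  (q2 : probability E2 R).
Hypothesis iid_tau : iid_law q2 tau.
Hypothesis nu_shift : forall h C, measurable C -> nu (@shiftz E1 h @^-1` C) = nu C.

Local Notation T := (zseq E1 * zseq E2)%type.
Local Notation m := (prod_prob nu tau).

Definition shift2 (h : int) (p : T) : T := (shiftz h p.1, shiftz h p.2).

Lemma measurable_shift2 h : measurable_fun setT (shift2 h).
Proof.
apply: measurable_fun_pair.
  exact: (measurableT_comp (@measurable_shiftz _ E1 h) measurable_fst).
exact: (measurableT_comp (@measurable_shiftz _ E2 h) measurable_snd).
Qed.

Lemma measurable_shift2_pre h (C : set T) : measurable C -> measurable (shift2 h @^-1` C).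
Proof. by move=> mC; rewrite -[X in measurable X]setTI; exact: (@measurable_shift2 h measurableT C mC). Qed.

Lemma measurable_shift_pre d (E : measurableType d) h (C : set (zseq E)) :
  measurable C -> measurable (@shiftz E h @^-1` C).
Proof. by move=> mC; rewrite -[X in measurable X]setTI; exact: (@measurable_shiftz _ E h measurableT C mC). Qed.

Definition cyl_rect : set (set T) :=
  [set C | exists A B, [/\ measurable A, cylinder B & C = A `*` B]].

Lemma cyl_rect_measurable C : cyl_rect C -> measurable C.
Proof.
by move=> [A [B [mA /cylinder_measurable mB ->]]]; exact: measurableX.
Qed.

Lemma cyl_rectI : setI_closed cyl_rect.
Proof.
move=> _ _ [A [B [mA cB ->]]] [A' [B' [mA' cB' ->]]].
exists (A `&` A'), (B `&` B'); split; [exact: measurableI|exact: cylinderI|].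
by rewrite setXI.
Qed.

Lemma cylinderT d (E : measurableType d) : @cylinder _ E setT.
Proof. by exists 0%N; exact: coord_sigmaT. Qed.

Lemma cyl_rectT : cyl_rect setT.
Proof. by exists setT, setT; split; rewrite ?setXTT//; exact: cylinderT. Qed.

Lemma cyl_rect_gen : @measurable _ T = <<s cyl_rect >>.
Proof.
apply/seteqP; split; last first.
  apply: smallest_sub; first exact: sigma_algebra_measurable.
  by move=> C; exact: cyl_rect_measurable.
apply: smallest_sub; first exact: smallest_sigma_algebra.
have sS : sigma_algebra setT <<s cyl_rect >> by exact: smallest_sigma_algebra.
move=> C [] [B mB <-]; rewrite setTI.
  apply: sub_sigma_algebra; exists B, setT; split => //; first exact: cylinderT.
  by apply/seteqP; split => p //= [].
suff : measurable `<=` image_set_system setT (snd : T -> zseq E2) <<s cyl_rect >>.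
  by move=> /(_ B mB); rewrite /image_set_system/= setTI.
rewrite cylinder_gen; apply: smallest_sub; first exact: sigma_algebra_image.
move=> D cD; rewrite /image_set_system/= setTI; apply: sub_sigma_algebra.
exists setT, D; split => //.
by apply/seteqP; split => p //= [].
Qed.

Lemma shift2_law h C : measurable C -> m (shift2 h @^-1` C) = m C.
Proof.
apply: (@eq_law_pi _ _ _ _ _ m m (shift2 h) cyl_rect).
- exact: measurable_shift2.
- exact: cyl_rect_gen.
- exact: cyl_rectI.
move=> _ [A [B [mA /cylinder_measurable mB ->]]].
rewrite (_ : _ @^-1` _ = (@shiftz E1 h @^-1` A) `*` (@shiftz E2 h @^-1` B))//.
rewrite !prod_probE//; [|exact: measurable_shift_pre..].
by rewrite nu_shift// (iid_shift iid_tau).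
Qed.

(** For large [n] the two cylinders involve disjoint windows. *)
Lemma iid_cylinder_mixing C D : cylinder C -> cylinder D ->
  \forall n \near \oo,
    tau (C `&` @shiftz E2 n%:Z @^-1` D) = (tau C * tau D)%E.
Proof.
move=> [M MC] [N ND]; exists (M + N).+1 => //= n /= MNn.
have mD := coord_sigma_measurable ND.
rewrite (@iid_indep _ _ _ _ _ iid_tau (window M))//.
  by rewrite (iid_shift iid_tau).
apply: (@coord_sigma_shiftz _ _ _ (window N)) ND => t /=.
by rewrite /window/=; lia.
Qed.

Section functional.
Variable Nul : (nat -> R) -> Prop.
Hypothesis idealN : null_ideal Nul.
(* The expected asymptotics r of m (A and T^-n B): the product m A * m B for
   mixing, the probability of an event with two independent noises for
   ergodicity. *)
Variable r : nat -> set T -> set T -> \bar R.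
Hypothesis r_addl : forall n A A' B, measurable A -> measurable A' -> measurable B ->
  A `&` A' = set0 -> r n (A `|` A') B = (r n A B + r n A' B)%E.
Hypothesis r_addr : forall n A B B', measurable A -> measurable B -> measurable B' ->
  B `&` B' = set0 -> r n A (B `|` B') = (r n A B + r n A B')%E.
Hypothesis r_bound : forall n A B, measurable A -> measurable B ->
  [/\ (0 <= r n A B)%E, (r n A B <= m A)%E & (r n A B <= m B)%E].

Definition discrepancy n (A B : set T) : R :=
  fine (m (A `&` shift2 n%:Z @^-1` B)) - fine (r n A B).

Hypothesis disc_rect : forall A B, cyl_rect A -> cyl_rect B ->
  Nul (fun n => discrepancy n A B).

Let r_fin n A B : measurable A -> measurable B -> r n A B \is a fin_num.
Proof.
move=> mA mB; have [r0 rA _] := r_bound n mA mB.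
by rewrite ge0_fin_numE// (le_lt_trans rA)// ltey_eq fin_num_measure.
Qed.

Let fine_measureU A B : measurable A -> measurable B -> A `&` B = set0 ->
  fine (m (A `|` B)) = fine (m A) + fine (m B).
Proof.
move=> mA mB AB0; rewrite -fineD; [|exact: fin_num_measure..].
by congr fine; exact: measureU.
Qed.

Let discrepancy_le n A B (C : set T) : measurable A -> measurable B -> measurable C ->
  (r n A B <= m C)%E -> (m (A `&` shift2 n%:Z @^-1` B) <= m C)%E ->
  `|discrepancy n A B| <= fine (m C).
Proof.
move=> mA mB mC rC mAC.
have [r0 _ _] := r_bound n mA mB.
have mABfin : m (A `&` shift2 n%:Z @^-1` B) \is a fin_num.
  by apply: fin_num_measure; apply: measurableI => //; exact: measurable_shift2_pre.
have mCfin : m C \is a fin_num by exact: fin_num_measure.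
have h1 : fine (r n A B) <= fine (m C) by apply: fine_le => //; exact: r_fin.
have h2 : fine (m (A `&` shift2 n%:Z @^-1` B)) <= fine (m C) by exact: fine_le.
have h3 : 0 <= fine (r n A B) by exact: fine_ge0.
have h4 : 0 <= fine (m (A `&` shift2 n%:Z @^-1` B)) by exact: fine_ge0.
by rewrite /discrepancy ler_norml; lra.
Qed.

Let discrepancy_addl n A A' B : measurable A -> measurable A' -> measurable B ->
  A `&` A' = set0 ->
  discrepancy n (A `|` A') B = discrepancy n A B + discrepancy n A' B.
Proof.
move=> mA mA' mB AA'; have mSB := measurable_shift2_pre n%:Z mB.
have mAB : measurable (A `&` shift2 n%:Z @^-1` B) by exact: measurableI.
have mAB' : measurable (A' `&` shift2 n%:Z @^-1` B) by exact: measurableI.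
have dAA' : A `&` shift2 n%:Z @^-1` B `&` (A' `&` shift2 n%:Z @^-1` B) = set0.
  by rewrite setIACA AA' set0I.
rewrite /discrepancy r_addl// setIUl (fine_measureU mAB mAB' dAA').
by rewrite (fineD (r_fin _ mA mB) (r_fin _ mA' mB)) opprD addrACA.
Qed.

Let discrepancy_addr n A B B' : measurable A -> measurable B -> measurable B' ->
  B `&` B' = set0 ->
  discrepancy n A (B `|` B') = discrepancy n A B + discrepancy n A B'.
Proof.
move=> mA mB mB' BB'; have mSB := measurable_shift2_pre n%:Z mB.
have mSB' := measurable_shift2_pre n%:Z mB'.
have mAB : measurable (A `&` shift2 n%:Z @^-1` B) by exact: measurableI.
have mAB' : measurable (A `&` shift2 n%:Z @^-1` B') by exact: measurableI.
have dBB' : A `&` shift2 n%:Z @^-1` B `&` (A `&` shift2 n%:Z @^-1` B') = set0.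
  have -> : set0 = A `&` A `&` shift2 n%:Z @^-1` (B `&` B').
    by rewrite BB' preimage_set0 setI0.
  by rewrite setIACA.
rewrite /discrepancy r_addr// preimage_setU setIUr (fine_measureU mAB mAB' dBB').
by rewrite (fineD (r_fin _ mA mB) (r_fin _ mA mB')) opprD addrACA.
Qed.

(** [null_dynkin], applied to each of the two events in turn. *)
Lemma discrepancy_null A B : measurable A -> measurable B ->
  Nul (fun n => discrepancy n A B).
Proof.
move=> mA mB.
apply: (@null_dynkin _ _ _ m Nul (fun n A => discrepancy n A B) cyl_rect) => //.
- by move=> n C C' mC mC'; exact: discrepancy_addl.
- move=> n C mC; apply: discrepancy_le => //; first by have [] := r_bound n mC mB.
  by apply: measureIl => //; exact: measurable_shift2_pre.
- exact: cyl_rect_gen.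
- exact: cyl_rectI.
- exact: cyl_rectT.
move=> C cC; have mC := cyl_rect_measurable cC.
apply: (@null_dynkin _ _ _ m Nul (fun n B => discrepancy n C B) cyl_rect) => //.
- by move=> n D D' mD mD'; exact: discrepancy_addr.
- move=> n D mD; apply: discrepancy_le => //; first by have [] := r_bound n mC mD.
  rewrite -[leRHS](shift2_law n%:Z mD).
  by apply: measureIr => //; exact: measurable_shift2_pre.
- exact: cyl_rect_gen.
- exact: cyl_rectI.
- exact: cyl_rectT.
by move=> D cD; exact: disc_rect.
Qed.

End functional.

End shifted_product.

(** * Mixing and weak mixing as decay of correlations *)

Section correlations.
Context (R : realType) d (E : measurableType d) (rho : probability (zseq E) R).

Definition correlation (n : nat) (A B : set (zseq E)) : R :=
  fine (rho (A `&` @shiftz E n%:Z @^-1` B)) - fine (rho A) * fine (rho B).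

Lemma iter_seq_shiftE n : iter n (@seq_shift E) = shiftz n%:Z.
Proof. by apply/funext => x; exact: iter_seq_shift. Qed.

Let fin_rho A : measurable A -> rho A = (fine (rho A))%:E.
Proof. by move=> mA; rewrite fineK// fin_num_measure. Qed.

Let measurable_corr n A B : measurable A -> measurable B ->
  measurable (A `&` @shiftz E n%:Z @^-1` B).
Proof. by move=> mA mB; apply: measurableI => //; exact: measurable_shift_pre. Qed.

Lemma mixingP : mixing rho <-> forall A B, measurable A -> measurable B ->
  cvg_null (fun n => correlation n A B).
Proof.
split=> mix A B mA mB.
  apply/subr_cvg0; apply: fine_cvg; rewrite EFinM -!fin_rho//.
  have := mix A B mA mB; apply: cvg_trans; apply: near_eq_cvg; apply: nearW => n.
  by rewrite iter_seq_shiftE.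
have /subr_cvg0 lim := mix A B mA mB.
rewrite (fin_rho mA) (fin_rho mB) -EFinM; apply: cvg_EFin.
  by apply: nearW => n; rewrite iter_seq_shiftE fin_num_measure//; exact: measurable_corr.
by move: lim; apply: cvg_trans; apply: near_eq_cvg; apply: nearW => n /=; rewrite iter_seq_shiftE.
Qed.

Lemma weakly_mixingP : weakly_mixing rho <-> forall A B, measurable A -> measurable B ->
  cesaro_null (fun n => correlation n A B).
Proof.
have wE A B n : measurable A -> measurable B ->
    ((n%:R^-1)%:E * \sum_(i < n)
      `|rho (A `&` iter i (@seq_shift E) @^-1` B) - rho A * rho B|)%E =
    (cesaro_abs (fun n => correlation n A B) n)%:E.
  move=> mA mB; rewrite /cesaro_abs EFinM -sumEFin; congr (_ * _)%E.
  apply: eq_bigr => i _; rewrite iter_seq_shiftE (fin_rho (measurable_corr i mA mB)).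
  by rewrite (fin_rho mA) (fin_rho mB).
split=> wm A B mA mB.
  have := wm A B mA mB; under eq_fun do rewrite wE//.
  by move=> /fine_cvg.
by under eq_fun do rewrite wE//; apply: cvg_EFin; [exact: nearW|exact: (wm A B)].
Qed.

End correlations.

(** * Mixing, weak mixing and ergodicity of a code *)

Section mixing_transfer.
Context (R : realType) d1 d2 d3 (E1 : measurableType d1) (E2 : measurableType d2)
  (E3 : measurableType d3).
Variables (nu : probability (zseq E1) R) (tau : probability (zseq E2) R)
  (q2 : probability E2 R) (g : E1 * E2 -> E3) (mu : probability (zseq E3) R).
Hypotheses (iid_tau : iid_law q2 tau) (mg : measurable_fun setT g).
Hypothesis nu_shift : forall h C, measurable C -> nu (@shiftz E1 h @^-1` C) = nu C.
Hypothesis muE : forall C, measurable C -> mu C = prod_prob nu tau (code g @^-1` C).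

Local Notation T := (zseq E1 * zseq E2)%type.
Local Notation m := (prod_prob nu tau).
Local Notation shift2 := (@shift2 _ _ E1 E2).

Let rect_corr n A B C D : measurable A -> measurable B -> measurable C -> measurable D ->
  m ((A `*` C) `&` shift2 n%:Z @^-1` (B `*` D)) =
  (nu (A `&` @shiftz E1 n%:Z @^-1` B) * tau (C `&` @shiftz E2 n%:Z @^-1` D))%E.
Proof.
move=> mA mB mC mD.
rewrite (_ : _ `&` _ = (A `&` @shiftz E1 n%:Z @^-1` B) `*`
                       (C `&` @shiftz E2 n%:Z @^-1` D)).
  by rewrite prod_probE//; apply: measurableI => //; exact: measurable_shift_pre.
by rewrite setXI.
Qed.

Let tau_corr C D : cylinder C -> cylinder D ->
  fine (tau (C `&` @shiftz E2 n%:Z @^-1` D)) - fine (tau C) * fine (tau D)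
    @[n --> \oo] --> (0 : R).
Proof.
move=> cC cD; apply: cvg_near_cst.
have := iid_cylinder_mixing iid_tau cC cD; apply: filterS => n ->.
have mC := cylinder_measurable cC; have mD := cylinder_measurable cD.
by rewrite fineM ?fin_num_measure// subrr.
Qed.

Let nu_le1 A : measurable A -> `|fine (nu A)| <= 1.
Proof.
move=> mA; rewrite ger0_norm; last exact: fine_ge0.
by rewrite -lee_fin fineK ?fin_num_measure//; exact: probability_le1.
Qed.

Let bounded_cvg0 (x y : nat -> R) : (forall n, `|x n| <= 1) ->
  y n @[n --> \oo] --> (0 : R) -> x n * y n @[n --> \oo] --> (0 : R).
Proof.
move=> x1 /cvgr0Pnorm_le y0; apply/cvgr0Pnorm_le => e e0.
have := y0 e e0; apply: filterS => n; apply: le_trans.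
by rewrite normrM ler_piMl.
Qed.

(** On rectangles over noise cylinders C' and D', the correlation is the one of
    [nu] multiplied by tau C' * tau D', up to a term that vanishes for large [n]
    because the noise mixes. *)
Lemma product_correlation (Nul : (nat -> R) -> Prop) : null_ideal Nul ->
  (forall A B, measurable A -> measurable B -> Nul (fun n => correlation nu n A B)) ->
  forall A B, measurable A -> measurable B ->
  Nul (fun n => fine (m (A `&` shift2 n%:Z @^-1` B)) - fine (m A) * fine (m B)).
Proof.
move=> idealN nuN A B mA mB.
have [Nadd Nscale Ncvg _] := idealN.
have := @discrepancy_null _ _ _ _ _ nu tau q2 iid_tau nu_shift Nul idealN
  (fun=> fun A B => (m A * m B)%E).
have fmM C D : measurable C -> measurable D ->
    fine (m C * m D) = fine (m C) * fine (m D).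
  by move=> mC mD; rewrite fineM ?fin_num_measure.
move=> /(_ _ _ _ _ A B mA mB) main.
have {}main : Nul (fun n => discrepancy nu tau (fun=> fun A B => (m A * m B)%E) n A B).
  apply: main.
  - move=> n C C' D mC mC' mD CC'; rewrite -ge0_muleDl//.
    by congr (_ * _)%E; exact: measureU.
  - move=> n C D D' mC mD mD' DD'; rewrite -ge0_muleDr//.
    by congr (_ * _)%E; exact: measureU.
  - move=> n C D mC mD; split; first exact: mule_ge0.
    + by rewrite -[leRHS]mule1 lee_pmul//; exact: probability_le1.
    + by rewrite -[leRHS]mul1e lee_pmul//; exact: probability_le1.
  move=> _ _ [C [C' [mC cC' ->]]] [D [D' [mD cD' ->]]].
  have mC' := cylinder_measurable cC'; have mD' := cylinder_measurable cD'.
  have := Nadd _ _ (Nscale (fine (tau C') * fine (tau D')) _ (nuN C D mC mD))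
    (Ncvg _ (bounded_cvg0 (fun n => nu_le1
      (measurableI _ _ mC (measurable_shift_pre n%:Z mD))) (tau_corr cC' cD'))).
  congr Nul; apply/funext => n; rewrite /discrepancy rect_corr// !prod_probE//.
  rewrite fineM ?fin_num_measure//; try by apply: measurableI => //; exact: measurable_shift_pre.
  rewrite fineM ?fin_numM ?fin_num_measure// !fineM ?fin_num_measure//.
  by rewrite /correlation; ring.
move: main; congr Nul; apply/funext => n.
by rewrite /discrepancy fmM.
Qed.

Lemma code_correlation (Nul : (nat -> R) -> Prop) : null_ideal Nul ->
  (forall A B, measurable A -> measurable B -> Nul (fun n => correlation nu n A B)) ->
  forall A B, measurable A -> measurable B -> Nul (fun n => correlation mu n A B).
Proof.
move=> idealN nuN A B mA mB.
have mcA := measurable_code_pre mg mA; have mcB := measurable_code_pre mg mB.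
have := product_correlation idealN nuN mcA mcB.
congr Nul; apply/funext => n; rewrite /correlation !muE//.
by apply: measurableI => //; exact: measurable_shift_pre.
Qed.

Lemma mixing_code : mixing nu -> mixing mu.
Proof. by move=> /mixingP mixnu; apply/mixingP; exact: (code_correlation (cvg_null_ideal R)). Qed.

Lemma weakly_mixing_code : weakly_mixing nu -> weakly_mixing mu.
Proof.
by move=> /weakly_mixingP mixnu; apply/weakly_mixingP; exact: (code_correlation (cesaro_null_ideal R)).
Qed.

(* A point (y, z) of the product with a second noise z', which stands for the
   noise as it is seen after a long time. *)
Let two_noise n (A B : set T) : set (T * zseq E2) :=
  [set w | A w.1 /\ B (shiftz n%:Z w.1.1, w.2)].

Let measurable_two_noise n A B : measurable A -> measurable B ->
  measurable (two_noise n A B).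
Proof.
move=> mA mB; apply: measurableI.
  by rewrite -[X in measurable X]setTI; apply: measurable_fst.
rewrite -[X in measurable X]setTI.
have : measurable_fun setT (fun w : T * zseq E2 => (shiftz n%:Z w.1.1, w.2)).
  apply: measurable_fun_pair; last exact: measurable_snd.
  apply: (measurableT_comp (@measurable_shiftz _ E1 n%:Z)).
  exact: (measurableT_comp measurable_fst measurable_fst).
exact.
Qed.

Let r n (A B : set T) : \bar R := prod_prob m tau (two_noise n A B).

Let r_bound n A B : measurable A -> measurable B ->
  [/\ (0 <= r n A B)%E, (r n A B <= m A)%E & (r n A B <= m B)%E].
Proof.
move=> mA mB; have mAB := measurable_two_noise n mA mB; split => //.
  rewrite -[leRHS]mule1 -(probability_setT tau) -prod_probE//.
  apply: le_measure; rewrite ?inE//; first exact: measurableX.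
  by move=> w [].
have -> : m B = prod_prob m tau (two_noise n setT B).
  rewrite [RHS]prod_prob_ysec; last exact: (measurable_two_noise n measurableT mB).
  rewrite prod_prob_ysec//; apply: eq_integral => z' _.
  have mBz : measurable [set y | B (y, z')] by exact: measurable_ysec.
  rewrite -(nu_shift n%:Z mBz) -[LHS]mule1 -(probability_setT tau).
  rewrite -prod_probE//; last exact: measurable_shift_pre.
  by congr (m _); apply/seteqP; split => -[y z] //= [].
apply: le_measure; rewrite ?inE//; first exact: (measurable_two_noise n measurableT mB).
by move=> w [].
Qed.

(* Past the horizon of the cylinders, the noise seen at time 0 and the noise
   seen at time n are independent, given the process. *)
Let decoupling A B : measurable A -> measurable B ->
  cvg_null (fun n => discrepancy nu tau r n A B).
Proof.
move=> mA mB.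
apply: (discrepancy_null iid_tau nu_shift (cvg_null_ideal R)) => //.
- move=> n C C' D mC mC' mD CC'; rewrite /r.
  rewrite (_ : two_noise n (C `|` C') D = two_noise n C D `|` two_noise n C' D).
    rewrite measureU//; [exact: (measurable_two_noise n mC mD)|exact: (measurable_two_noise n mC' mD)|].
    apply/seteqP; split => w //= [[Cw _] [Cw' _]].
    by have : (C `&` C') w.1 by []; rewrite CC'.
  by apply/seteqP; split => w /=; rewrite /two_noise /setU /=; tauto.
- move=> n C D D' mC mD mD' DD'; rewrite /r.
  rewrite (_ : two_noise n C (D `|` D') = two_noise n C D `|` two_noise n C D').
    rewrite measureU//; [exact: (measurable_two_noise n mC mD)|exact: (measurable_two_noise n mC mD')|].
    apply/seteqP; split => w //= [[_ Dw] [_ Dw']].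
    by have : (D `&` D') (shiftz n%:Z w.1.1, w.2) by []; rewrite DD'.
  by apply/seteqP; split => w /=; rewrite /two_noise /setU /=; tauto.
move=> _ _ [C [C' [mC cC' ->]]] [D [D' [mD cD' ->]]].
have mC' := cylinder_measurable cC'; have mD' := cylinder_measurable cD'.
have mCD n := measurableI _ _ mC (measurable_shift_pre n%:Z mD).
have := bounded_cvg0 (fun n => nu_le1 (mCD n)) (tau_corr cC' cD').
congr cvg_null; apply/funext => n; rewrite /discrepancy rect_corr// /r.
rewrite (_ : two_noise _ _ _ = ((C `&` @shiftz E1 n%:Z @^-1` D) `*` C') `*` D').
  rewrite prod_probE//; last exact: measurableX.
  rewrite prod_probE// !fineM ?fin_numM ?fin_num_measure//; first by rewrite mulrBr mulrA.
  by apply: measurableI => //; exact: measurable_shift_pre.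
by apply/seteqP; split => -[[y z] z'] /=; rewrite /two_noise /=; tauto.
Qed.

Section invariant_events.
Variable A : set T.
Hypotheses (mA : measurable A) (invA : shift2 1 @^-1` A = A).

Let inv_shift n : shift2 n%:Z @^-1` A = A.
Proof.
elim: n => [|n IH].
  apply/seteqP; split => -[y z]; rewrite /preimage/shift2/=;
    have sh0 (E : Type) (x : zseq E) : shiftz 0 x = x by
      (apply/funext => t; rewrite /shiftz addr0).
    by rewrite !sh0.
  by rewrite !sh0.
rewrite -[RHS]IH -[in RHS]invA; apply/seteqP; split => -[y z]; rewrite /preimage/shift2/=;
  have shS (E : Type) (x : zseq E) : shiftz 1 (shiftz n%:Z x) = shiftz n.+1%:Z x by
    (apply/funext => t; rewrite /shiftz -addrA; congr (x (t + _)); rewrite -natz; lia).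
  by rewrite !shS.
by rewrite !shS.
Qed.

Let h (y : zseq E1) : \bar R := tau [set z | A (y, z)].

Let h_shift n y : h (shiftz n%:Z y) = h y.
Proof.
rewrite /h -(iid_shift iid_tau n%:Z); last exact: measurable_xsec.
congr (tau _); apply/seteqP; split => z /=; have := inv_shift n => /seteqP[AS SA].
  by move=> Az; exact: (AS (y, z)).
by move=> Az; exact: (SA (y, z)).
Qed.

(* For an invariant event the discrepancy is constant in n; as it tends to 0, it
   vanishes. *)
Let A_two_noise : m A = r 0 A A.
Proof.
have rn n : r n A A = r 0 A A.
  rewrite /r !prod_prob_xsec; apply: eq_integral => -[y z] _.
  have [Ap|nAp] := pselect (A (y, z)).
    transitivity (h (shiftz n%:Z y)).
      by congr (tau _); apply/seteqP; split => z' //= [].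
    transitivity (h (shiftz 0%:Z y)); first by rewrite !h_shift.
    by congr (tau _); apply/seteqP; split => z' //= [].
  by congr (tau _); apply/seteqP; split => z' //= [].
have := decoupling mA mA.
have -> : (fun n => discrepancy nu tau r n A A) = (fun=> fine (m A) - fine (r 0 A A)).
  by apply/funext => n; rewrite /discrepancy inv_shift setIid rn.
move=> /cvg_lim; rewrite lim_cst// => /(_ (@Rhausdorff R))/eqP.
rewrite subr_eq0 => /eqP mr.
have [r0 rA _] := r_bound 0 mA mA.
rewrite -[LHS]fineK ?fin_num_measure// mr fineK//.
by rewrite ge0_fin_numE// (le_lt_trans rA)// ltey_eq fin_num_measure.
Qed.

(** By [A_two_noise], given the process [A] has the same probability for one
    noise as for two independent noises at once: [A] is independent of itself
    and its conditional probability [h] is 0 or 1 almost surely. So [A] is, up to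
    a null set, the event h = 1 of the process, which is invariant. *)
Lemma invariant_event_ergodic : ergodic nu -> m A = 0%E \/ m A = 1%E.
Proof.
move=> ergnu.
pose H := [set y | h y = 1%E].
have mh : measurable_fun setT h by exact: measurable_fun_xsec.
have mH : measurable H.
  by rewrite -[X in measurable X]setTI; exact: (mh measurableT _ (emeasurable_set1 1%E)).
suff -> : m A = nu H.
  apply: ergnu => //; apply/seteqP; split => y; rewrite /H/preimage/=.
    by rewrite -(h_shift 1 y).
  by rewrite -{1}(h_shift 1 y).
pose f p := tau [set z' | A p /\ ~ A (p.1, z')].
pose W : set (T * zseq E2) := [set w | A w.1 /\ ~ A (w.1.1, w.2)].
have mW1 : measurable [set w : T * zseq E2 | A w.1].
  by rewrite -[X in measurable X]setTI; apply: measurable_fst.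
have mpr : measurable_fun setT (fun w : T * zseq E2 => (w.1.1, w.2)).
  apply: measurable_fun_pair; last exact: measurable_snd.
  exact: (measurableT_comp measurable_fst measurable_fst).
have mW2 : measurable [set w : T * zseq E2 | A (w.1.1, w.2)].
  by rewrite -[X in measurable X]setTI; exact: mpr.
have mW : measurable W by apply: measurableI => //; exact: measurableC.
have W0 : prod_prob m tau W = 0%E.
  have : prod_prob m tau (A `*` setT) = (m A * tau setT)%E by rewrite prod_probE.
  rewrite probability_setT mule1.
  have -> : A `*` setT = W `|` two_noise 0 A A.
    have sh0 (x : zseq E1) : shiftz 0%:Z x = x by apply/funext => t; rewrite /shiftz addr0.
    apply/seteqP; split => -[[y z] z']; rewrite /W /two_noise /= sh0; first by move=> [? _]; have := pselect (A (y, z')); tauto.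
    by tauto.
  rewrite measureU//; last 2 first.
  - exact: measurable_two_noise.
  - have sh0 (x : zseq E1) : shiftz 0%:Z x = x by apply/funext => t; rewrite /shiftz addr0.
    by apply/seteqP; split => -[[y z] z']; rewrite /W /two_noise /= sh0; tauto.
  rewrite -[X in (_ + X)%E]/(r 0 A A) -A_two_noise.
  have mAfin : m A \is a fin_num by exact: fin_num_measure.
  have Wfin : prod_prob m tau W \is a fin_num by exact: fin_num_measure.
  move=> /(congr1 (fun x => x - m A)%E); rewrite [RHS]subee//.
  by move=> <-; exact/esym/addeK.
have mf : measurable_fun setT f by exact: (measurable_fun_xsec tau mW).
have [N [mN N0 fN]] : {ae m, forall p, f p = 0%E}.
  have : ae_eq m setT f (cst 0%E).
    apply/ae_eq_integral_abs => //; rewrite -[RHS]W0 prod_prob_xsec.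
    by apply: eq_integral => p _; rewrite gee0_abs.
  by apply: filterS => p; exact.
pose V := (H `*` setT) `\` A.
have mV : measurable V by apply: measurableD => //; exact: measurableX.
have V0 : m V = 0%E.
  rewrite prod_prob_xsec; apply: integral0_eq => y _.
  have mAy : measurable [set z | A (y, z)] by exact: measurable_xsec.
  have [Hy|nHy] := pselect (H y); last first.
    by rewrite (_ : [set z | _] = set0) ?measure0//; apply/seteqP; split => z //= [[]].
  rewrite (_ : [set z | _] = ~` [set z | A (y, z)]).
    by rewrite probability_setC// -[X in (_ - X)%E]/(h y) Hy subee.
  by apply/seteqP; split => z //= [].
transitivity (m (H `*` setT)).
  apply: (@eq_prob_mod_null _ _ _ m _ _ (N `|` V)) => //.
  - exact: measurableX.
  - exact: measurableU.
  - exact: null_set_setU.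
  move=> [y z] /not_orP[nN nV]; split => [Ap|[Hy _]]; last first.
    by apply: contrapT => nAp; apply: nV.
  split => //; rewrite /H/=.
  have : f (y, z) = 0%E by apply: contrapT => /fN.
  have mAy : measurable [set z | A (y, z)] by exact: measurable_xsec.
  rewrite /f (_ : [set z' | _] = ~` [set z | A (y, z)]); last first.
    by apply/seteqP; split => z' //= [].
  rewrite probability_setC// -/(h y).
  have hfin : h y \is a fin_num by exact: fin_num_measure.
  by rewrite -(fineK hfin) => -[h1]; congr EFin; lra.
by rewrite prod_probE// [X in (_ * X)%E]probability_setT mule1.
Qed.

End invariant_events.

Lemma ergodic_code : ergodic nu -> ergodic mu.
Proof.
move=> ergnu C mC invC; rewrite muE//.
apply: invariant_event_ergodic => //; first exact: measurable_code_pre.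
by rewrite -[in RHS]invC.
Qed.

End mixing_transfer.

(** * Lower integrals and families of probabilities *)

Section integral_transport.
Context d1 d2 (T1 : measurableType d1) (T2 : measurableType d2) (R : realType).
Local Open Scope ereal_scope.

Lemma integral_law (P : probability T1 R) (Q : probability T2 R) (X : T1 -> T2)
    (f : T2 -> \bar R) : measurable_fun setT X ->
  (forall A, measurable A -> Q A = P (X @^-1` A)) ->
  measurable_fun setT f -> (forall x, 0 <= f x) ->
  \int[Q]_x f x = \int[P]_x f (X x).
Proof.
move=> mX QP mf f0.
have law A : measurable A -> distribution P (to_mfun mX) A = Q A.
  by move=> mA; rewrite (QP A mA).
transitivity (\int[distribution P (to_mfun mX)]_z f z).
  by apply: eq_measure_integral => A mA _; exact/esym/law.
by rewrite ge0_integral_distribution.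
Qed.

End integral_transport.

Section lower_integral.
Import HBNNSimple.
Context d (T : measurableType d) (R : realType) (P : probability T R).
Local Open Scope ereal_scope.

(** A bound for the measurable minorants of a function that may itself fail to
    be measurable. *)
Lemma integral_le_lower (h : T -> \bar R) (M : \bar R) : (forall x, 0 <= h x) ->
  (forall f, measurable_fun setT f -> (forall x, 0 <= f x) ->
    (forall x, f x <= h x) -> \int[P]_x f x <= M) ->
  \int[P]_x h x <= M.
Proof.
move=> h0 hM; rewrite ge0_integralTE//; apply: ge_ereal_sup => _ [s sh <-].
rewrite -integralT_nnsfun//; apply: hM => //; first exact/measurable_EFinP.
by move=> x; rewrite lee_fin.
Qed.

Lemma ae_le_lower_integral (f h : T -> \bar R) (N : set T) :
  measurable_fun setT f -> (forall x, 0 <= f x) -> (forall x, 0 <= h x) ->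
  measurable N -> P N = 0 -> (forall x, ~ N x -> f x <= h x) ->
  \int[P]_x f x <= \int[P]_x h x.
Proof.
move=> mf f0 h0 mN N0 fh.
pose f' := f \_ (~` N).
have mf' : measurable_fun setT f'.
  by apply/(measurable_restrictT _ _).1; [exact: measurableC|exact: measurable_funTS].
have f'0 x : 0 <= f' x by exact: erestrict_ge0.
rewrite (@ge0_ae_eq_integral _ _ _ P setT f f')//.
  apply: ge0_le_lower_integral => // x; rewrite /f' patchE; case: ifPn => //.
  by rewrite inE => /fh.
exists N; split => // x /= fx; apply: contrapT => nNx; apply: fx => _.
by rewrite /f' patchE mem_set.
Qed.

End lower_integral.

Section probability_family.
Context d1 d2 (X : measurableType d1) (Y : measurableType d2) (R : realType).
Variable k : X -> probability Y R.
Hypothesis mk : forall B, measurable B -> measurable_fun setT (fun x => k x B).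
Local Open Scope ereal_scope.

Let kk : X -> {measure set Y -> \bar R} := k.

HB.instance Definition _ := isKernel.Build _ _ X Y R kk mk.

Let kk1 x : kk x setT = 1. Proof. exact: probability_setT. Qed.

HB.instance Definition _ := Kernel_isProbability.Build _ _ X Y R kk kk1.

Lemma measurable_family_sec (C : set (X * Y)) : measurable C ->
  measurable_fun setT (fun x => k x [set y | C (x, y)]).
Proof.
move=> mC; have := measurable_fun_xsection_finite_kernel kk (mem_set mC).
by congr measurable_fun; apply/funext => x; rewrite xsecE.
Qed.

End probability_family.

(** * Absolute regularity of a code *)

Section absolute_regularity.
Context (R : realType) d1 d2 d3 (E1 : measurableType d1) (E2 : measurableType d2)
  (E3 : measurableType d3).
Variables (nu : probability (zseq E1) R) (tau : probability (zseq E2) R)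
  (q2 : probability E2 R) (g : E1 * E2 -> E3) (mu : probability (zseq E3) R)
  (dec : E3 -> E1) (kappa : zseq E1 -> probability (zseq E1) R).
Local Notation code := (code g).
Local Notation sec := (code_sec g).
Local Notation decode := (decode dec).
Local Notation Past := [set t : int | t <= 0].

Hypotheses (iid_tau : iid_law q2 tau) (mg : measurable_fun setT g).
Hypothesis muE : forall C, measurable C -> mu C = prod_prob nu tau (code @^-1` C).
Hypothesis mdec : measurable_fun setT dec.
Hypothesis decK : {ae prod_prob nu tau, forall p, decode (code p) = p.1}.
Hypothesis reg_kappa : regular_cond_past nu kappa.

Local Open Scope ereal_scope.

Let kappa_past y y' B : measurable B -> (forall t, Past t -> y t = y' t) ->
  kappa y B = kappa y' B.
Proof.
move=> mB yy'; have mY : measurable [set kappa y' B] by exact: emeasurable_set1.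
have := coord_sigma_sat (reg_kappa.1 B _ mB mY) yy'.
by rewrite /preimage/= => ->.
Qed.

Let mkappa B : measurable B -> measurable_fun setT (fun y => kappa y B).
Proof.
move=> mB _ Y mY; rewrite setTI.
exact: (coord_sigma_measurable (reg_kappa.1 B Y mB mY)).
Qed.

Let mkappa_dec B : measurable B -> measurable_fun setT (fun u => kappa (decode u) B).
Proof.
move=> mB; exact: (measurableT_comp (mkappa mB) (measurable_decode mdec)).
Qed.

(* Given the past u of the code: keep the past, draw the future of the process
   from kappa at the decoded past, and draw a fresh future of the noise. *)
Let renew (u : zseq E3) (p : zseq E1 * zseq E2) : zseq E3 := splice Past u (code p).

Let measurable_renew2 : measurable_fun setT
  (fun w : zseq E3 * (zseq E1 * zseq E2) => renew w.1 w.2).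
Proof.
have mpair : measurable_fun setT
    (fun w : zseq E3 * (zseq E1 * zseq E2) => (w.1, code w.2)).
  apply: measurable_fun_pair; first exact: measurable_fst.
  exact: (measurableT_comp (measurable_code mg) measurable_snd).
exact: (measurableT_comp (measurable_splice (E := E3) Past) mpair).
Qed.

Let measurable_renew u : measurable_fun setT (renew u).
Proof.
exact: (measurableT_comp measurable_renew2 (pair1_measurable u)).
Qed.

Definition code_kernel (u : zseq E3) : probability (zseq E3) R :=
  distribution (prod_prob (kappa (decode u)) tau) (to_mfun (measurable_renew u)).

Lemma code_kernelE u B :
  code_kernel u B = prod_prob (kappa (decode u)) tau (renew u @^-1` B).
Proof. by []. Qed.

Let code_kernel_sec u B : measurable B -> code_kernel u B =
  \int[tau]_z kappa (decode u) [set y | B (renew u (y, z))].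
Proof.
move=> mB; rewrite code_kernelE prod_prob_ysec//.
by rewrite -[X in measurable X]setTI; exact: (measurable_renew u).
Qed.

Let measurable_code_kernel B : measurable B ->
  measurable_fun setT (fun u => code_kernel u B).
Proof.
move=> mB; under eq_fun do rewrite code_kernel_sec//.
pose C := [set w : (zseq E3 * zseq E2) * zseq E1 | B (renew w.1.1 (w.2, w.1.2))].
have mC : measurable C.
  rewrite -[X in measurable X]setTI.
  have mre : measurable_fun setT (fun w : (zseq E3 * zseq E2) * zseq E1 =>
      (w.1.1, (w.2, w.1.2))).
    apply: measurable_fun_pair.
      exact: (measurableT_comp measurable_fst measurable_fst).
    apply: measurable_fun_pair; first exact: measurable_snd.
    exact: (measurableT_comp measurable_snd measurable_fst).
  exact: (measurableT_comp measurable_renew2 mre).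
have mk (D : set (zseq E1)) : measurable D ->
    measurable_fun setT (fun x : zseq E3 * zseq E2 => kappa (decode x.1) D).
  by move=> mD; exact: (measurableT_comp (mkappa_dec mD) measurable_fst).
have := measurable_family_sec mk mC.
by move=> mf; apply: (measurable_fun_fubini_tonelli_F (m2 := tau) _ mf).
Qed.

Let code_kernel_past u u' B : measurable B -> (forall t, Past t -> u t = u' t) ->
  code_kernel u B = code_kernel u' B.
Proof.
move=> mB uu'; rewrite !code_kernel_sec//; apply: eq_integral => z _.
have -> : [set y | B (renew u (y, z))] = [set y | B (renew u' (y, z))].
  apply/seteqP; split => y /=; congr B; apply/funext => t;
    by rewrite /renew /splice; case: asboolP => // /uu'.
apply: kappa_past; last by move=> t /uu' ut; rewrite /decode ut.
rewrite (_ : [set y | _] = (fun y => renew u' (y, z)) @^-1` B)//.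
rewrite -[X in measurable X]setTI.
exact: (measurableT_comp (measurable_renew u') (pair2_measurable z)).
Qed.

Let code_kernel_future u B : coord_sigma (~` Past) B ->
  code_kernel u B = \int[tau]_z kappa (decode u) (sec B z).
Proof.
move=> fB; rewrite code_kernel_sec; last exact: coord_sigma_measurable fB.
apply: eq_integral => z _; congr (kappa _ _); apply/seteqP; split => y /=.
  by rewrite /renew (coord_sigma_spliceC _ _ _ fB).
by rewrite /renew (coord_sigma_spliceC _ _ _ fB).
Qed.

Let integral_mu_code f : measurable_fun setT f -> (forall u, 0 <= f u) ->
  \int[mu]_u f u = \int[prod_prob nu tau]_p f (code p).
Proof. by move=> mf f0; apply: integral_law => //; exact: measurable_code. Qed.

Let integral_if (dT : measure_display) (T : measurableType dT) (P : probability T R)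
    (A : set T) (f : T -> \bar R) :
  \int[P]_(x in A) f x = \int[P]_x (if `[< A x >] then f x else 0).
Proof.
rewrite integral_mkcond; apply: eq_integral => x _; rewrite patchE.
by case: asboolP => Ax; [rewrite mem_set|rewrite memNset].
Qed.

Let measurable_if (dT : measure_display) (T : measurableType dT)
    (A : set T) (f : T -> \bar R) : measurable A -> measurable_fun setT f ->
  measurable_fun setT (fun x => if `[< A x >] then f x else 0).
Proof.
move=> mA mf; apply: measurable_fun_ifT => //.
apply: (@measurable_fun_bool _ _ _ _ true); rewrite setTI.
rewrite (_ : _ @^-1` _ = A)//.
by apply/seteqP; split => y /=; [move/asboolP|move=> ?; exact/asboolP].
Qed.

(* For each frozen noise z, the section of A is a past event of the process, so
   that the defining property of kappa applies to it. *)
Let integral_kappa_past A D : coord_sigma Past A -> measurable D ->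
  \int[mu]_(u in A) kappa (decode u) D = \int[tau]_z nu (sec A z `&` D).
Proof.
move=> pA mD; have mA := coord_sigma_measurable pA.
rewrite integral_if integral_mu_code; first last.
- by move=> u; case: ifP.
- by apply: measurable_if => //; exact: mkappa_dec.
pose f (p : zseq E1 * zseq E2) := if `[< A (code p) >] then kappa p.1 D else 0.
have mf : measurable_fun setT f.
  apply: (@measurable_if _ _ (code @^-1` A) (fun p => kappa p.1 D)).
    exact: measurable_code_pre.
  exact: (measurableT_comp (mkappa mD) measurable_fst).
have f0 p : 0 <= f p by rewrite /f; case: ifP.
transitivity (\int[prod_prob nu tau]_p f p).
  apply: ge0_ae_eq_integral => //.
  - apply: (@measurable_if _ _ (code @^-1` A) (fun p => kappa (decode (code p)) D)).
      exact: measurable_code_pre.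
    exact: (measurableT_comp (mkappa_dec mD) (measurable_code mg)).
  - by move=> p _; case: ifP.
  by apply: filterS decK => p dp _; rewrite /f dp.
transitivity (\int[tau]_z \int[nu]_y f (y, z)).
  exact: (fubini_tonelli2 (m1 := nu) (m2 := tau) _ mf f0).
apply: eq_integral => z _; rewrite -(reg_kappa.2 _ _ (coord_sigma_sec mg z pA) mD).
by rewrite [RHS]integral_if.
Qed.

(* The past event A and the future event B read the noise at disjoint sets of
   times, so that the fresh noise z' of the kernel may be spliced to the noise z
   that produced the past. *)
Let regular_future A B : coord_sigma Past A -> coord_sigma (~` Past) B ->
  \int[mu]_(u in A) code_kernel u B = mu (A `&` B).
Proof.
move=> pA fB.
have mA := coord_sigma_measurable pA; have mB := coord_sigma_measurable fB.
have mAB : measurable (A `&` B) by exact: measurableI.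
pose f (w : zseq E3 * zseq E2) := if `[< A w.1 >] then kappa (decode w.1) (sec B w.2) else 0.
have f0 w : 0 <= f w by rewrite /f; case: ifP.
have mf : measurable_fun setT f.
  apply: (@measurable_if _ _ [set w : zseq E3 * zseq E2 | A w.1]
    (fun w => kappa (decode w.1) (sec B w.2))).
    by rewrite -[X in measurable X]setTI; apply: measurable_fst.
  pose C := [set w : (zseq E3 * zseq E2) * zseq E1 | B (code (w.2, w.1.2))].
  have mC : measurable C.
    rewrite -[X in measurable X]setTI.
    have mre : measurable_fun setT (fun w : (zseq E3 * zseq E2) * zseq E1 => (w.2, w.1.2)).
      apply: measurable_fun_pair; first exact: measurable_snd.
      exact: (measurableT_comp measurable_snd measurable_fst).
    exact: (measurableT_comp (measurable_code mg) mre).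
  have mk (D : set (zseq E1)) : measurable D ->
      measurable_fun setT (fun x : zseq E3 * zseq E2 => kappa (decode x.1) D).
    by move=> mD; exact: (measurableT_comp (mkappa_dec mD) measurable_fst).
  exact: (measurable_family_sec mk mC).
transitivity (\int[mu]_u \int[tau]_z f (u, z)).
  rewrite integral_if; apply: eq_integral => u _; rewrite code_kernel_future// /f/=.
  by case: ifP => // _; rewrite integral0.
transitivity (\int[tau]_z' \int[mu]_u f (u, z')).
  exact: (fubini_tonelli (m1 := mu) (m2 := tau) _ mf f0).
transitivity (\int[tau]_z' \int[tau]_z nu (sec A z `&` sec B z')).
  apply: eq_integral => z' _; rewrite -integral_kappa_past//; last exact: (measurable_sec mg).
  by rewrite [RHS]integral_if.
have msec := measurable_fun_sec nu mg mAB.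
rewrite (mu_sec mg muE mAB) (tau_splice iid_tau (~` Past) msec); last by [].
apply: eq_integral => z' _; apply: eq_integral => z _.
rewrite code_secI (code_sec_spliceC _ _ _ _ pA); last by rewrite setCK.
by rewrite (code_sec_splice _ _ _ _ fB).
Qed.

(** The kernel copies the past verbatim, so that a past event can be moved from
    its argument into the domain of integration. This reduces the identity to
    [regular_future] on the pi-system of intersections of a past and a future
    event. *)
Lemma regular_code_kernel : regular_cond_past mu code_kernel.
Proof.
split=> [B Y mB mY|A B pA mB].
  apply: coord_sigma_factor.
    by rewrite -[X in measurable X]setTI; exact: (measurable_code_kernel mB).
  by move=> u u' uu' Yu; exact: (eq_ind _ Y Yu _ (code_kernel_past mB uu')).
move: B mB; have mA := coord_sigma_measurable pA.
have mUA B : measurable B -> measurable (A `&` B) by exact: measurableI.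
have mfA B : measurable B -> measurable_fun A (fun u => code_kernel u B).
  by move=> mB; apply: measurable_funTS; exact: measurable_code_kernel.
suff dyn B : <<s (@split_rect _ E3 Past) >> B ->
    \int[mu]_(u in A) code_kernel u B = mu (A `&` B).
  by move=> B mB; apply: dyn; rewrite -split_rect_gen.
apply: (@dynkin_induction _ _ (@split_rect _ E3 Past)
  (fun B => \int[mu]_(u in A) code_kernel u B = mu (A `&` B))).
- exact: split_rect_gen.
- exact: split_rectI.
- under eq_integral do rewrite probability_setT.
  by rewrite integral_cst//= mul1e setIT.
- move=> _ [B1 [B2 [pB1 fB2 ->]]].
  have mB1 := coord_sigma_measurable pB1; have mB2 := coord_sigma_measurable fB2.
  have pAB1 : coord_sigma Past (A `&` B1) by exact: coord_sigmaI.
  rewrite setIA -(regular_future pAB1 fB2) integral_if [RHS]integral_if.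
  apply: eq_integral => u _.
  have [Au|nAu] := pselect (A u); last first.
    by rewrite asboolF// asboolF// => -[].
  rewrite asboolT//; have [B1u|nB1u] := pselect (B1 u).
    rewrite asboolT// !code_kernelE; congr (prod_prob _ _ _).
    apply/seteqP; split => p /=; rewrite /preimage /setI /= /renew;
      rewrite (coord_sigma_splice _ _ _ pB1)//; tauto.
  rewrite asboolF; last by case.
  rewrite code_kernelE (_ : _ @^-1` _ = set0) ?measure0//.
  apply/seteqP; split => p //=; rewrite /preimage /setI /= /renew.
  by rewrite (coord_sigma_splice _ _ _ pB1)//; tauto.
- move=> S mS IH.
  have Sfin : mu (A `&` S) \is a fin_num by apply: fin_num_measure; exact: mUA.
  have split1 : \int[mu]_(u in A) code_kernel u S +
      \int[mu]_(u in A) code_kernel u (~` S) = mu A.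
    rewrite -ge0_integralD//; [|exact: mfA|by apply: mfA; exact: measurableC].
    transitivity (\int[mu]_(u in A) (1 : \bar R)).
      apply: eq_integral => u _; rewrite probability_setC// addeC subeK//.
      exact: fin_num_measure.
    by rewrite integral_cst// mul1e.
  have split2 : mu (A `&` S) + mu (A `&` ~` S) = mu A.
    by rewrite addeC -setDE; apply/esym; exact: measureDI.
  move: split1; rewrite IH -split2 => /(congr1 (fun x => x - mu (A `&` S))).
  by rewrite ![mu (A `&` S) + _]addeC !addeK.
- move=> F mF tF IH.
  transitivity (\int[mu]_(u in A) (\sum_(k <oo) code_kernel u (F k))).
    apply: eq_integral => u _; apply/esym/cvg_lim => //.
    exact: measure_sigma_additive.
  rewrite integral_nneseries//; last by move=> n; exact: mfA.
  rewrite setI_bigcupr; apply/esym.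
  transitivity (\sum_(k <oo) mu (A `&` F k)); last by apply: eq_eseriesr => k _; rewrite IH.
  apply/esym/cvg_lim => //; apply: measure_sigma_additive.
    by move=> k; exact: mUA.
  exact: trivIset_setIl.
Qed.

Let variation_nu n y := ereal_sup [set `|kappa y B - nu B| | B in future n].
Let variation_mu n u := ereal_sup [set `|code_kernel u B - mu B| | B in future n].

Let variation_nu_ge0 n y : 0 <= variation_nu n y.
Proof.
apply: le_ereal_sup_tmp; exists `|kappa y setT - nu setT|; last exact: abse_ge0.
by exists setT => //; exact: coord_sigmaT.
Qed.

Let variation_mu_ge0 n u : 0 <= variation_mu n u.
Proof.
apply: le_ereal_sup_tmp; exists `|code_kernel u setT - mu setT|; last exact: abse_ge0.
by exists setT => //; exact: coord_sigmaT.
Qed.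

Let variation_le n u : (0 < n)%N -> variation_mu n u <= variation_nu n (decode u).
Proof.
move=> n0; apply: ge_ereal_sup => _ [B fB <-].
have mB := coord_sigma_measurable fB.
rewrite (code_kernel_future _ (future_compl_past n0 fB)) (mu_sec mg muE mB).
rewrite -[leRHS](integral_cst_prob tau); apply: integral_dist_le => //.
- exact: (measurable_fun_sec _ mg mB).
- exact: (measurable_fun_sec _ mg mB).
- by move=> z; rewrite measure_ge0 probability_le1//; exact: (measurable_sec mg).
- by move=> z; rewrite measure_ge0 probability_le1//; exact: (measurable_sec mg).
move=> z; apply: ereal_sup_ubound; exists (sec B z) => //.
exact: (coord_sigma_sec mg).
Qed.

(* A measurable minorant f of the variation for the code yields one for the
   process, almost everywhere: the mean of f (code (y, z)) over z. *)
Let beta_le n : (0 < n)%N ->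
  \int[mu]_u variation_mu n u <= \int[nu]_y variation_nu n y.
Proof.
move=> n0; apply: integral_le_lower => // f mf f0 fle.
have [N [mN N0 decN]] := decK.
have mfc : measurable_fun setT (fun p => f (code p)).
  exact: (measurableT_comp mf (measurable_code mg)).
rewrite integral_mu_code// (fubini_tonelli1 (m1 := nu) (m2 := tau) _ mfc)//.
pose bad := [set y | tau [set z | N (y, z)] != 0].
have mtN := measurable_fun_xsec tau mN.
have mbad : measurable bad.
  by rewrite /bad -[X in measurable X]setTI; exact: emeasurable_neq.
have bad0 : nu bad = 0.
  have : ae_eq nu setT (fun y => tau [set z | N (y, z)]) (cst 0).
    apply/ae_eq_integral_abs => //; rewrite -[RHS]N0 prod_prob_xsec.
    by apply: eq_integral => p _; rewrite gee0_abs.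
  move=> [V [mV V0 badV]]; apply: (subset_measure0 mbad mV) => // y /eqP by_.
  by apply: badV => /(_ I).
apply: (@ae_le_lower_integral _ _ _ nu _ _ bad) => //.
- exact: (measurable_fun_fubini_tonelli_F (m2 := tau) _ mfc).
- by move=> y; exact: integral_ge0.
move=> y /negP; rewrite negbK => /eqP Ny0.
rewrite /fubini_F -[leRHS](integral_cst_prob tau).
apply: (@ae_le_lower_integral _ _ _ tau _ _ [set z | N (y, z)]) => //.
- exact: (measurableT_comp mfc (pair1_measurable y)).
- exact: measurable_xsec.
move=> z nN; apply: (le_trans (fle _)); apply: (le_trans (variation_le _ n0)).
by have -> : decode (code (y, z)) = y by apply: contrapT => /decN.
Qed.

(* A minorant for the process is composed with the decoder. For almost every y
   the code can be decoded almost surely under kappa y too: averaging over y, the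
   null set N of decK keeps measure 0. *)
Let beta_ge n : (0 < n)%N ->
  \int[nu]_y variation_nu n y <= \int[mu]_u variation_mu n u.
Proof.
move=> n0; apply: integral_le_lower => // f mf f0 fle.
have [N [mN N0 decN]] := decK.
rewrite (@integral_law _ _ _ _ _ mu nu decode f (measurable_decode mdec))//; last first.
  by move=> A mA; rewrite (decode_law mg muE mdec decK).
have mkN : measurable_fun setT (fun y => prod_prob (kappa y) tau N).
  under eq_fun do rewrite prod_prob_ysec//.
  pose C := [set w : (zseq E1 * zseq E2) * zseq E1 | N (w.2, w.1.2)].
  have mC : measurable C.
    rewrite -[X in measurable X]setTI.
    have mre : measurable_fun setT (fun w : (zseq E1 * zseq E2) * zseq E1 => (w.2, w.1.2)).
      apply: measurable_fun_pair; first exact: measurable_snd.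
      exact: (measurableT_comp measurable_snd measurable_fst).
    exact: mre.
  have mk (D : set (zseq E1)) : measurable D ->
      measurable_fun setT (fun x : zseq E1 * zseq E2 => kappa x.1 D).
    by move=> mD; exact: (measurableT_comp (mkappa mD) measurable_fst).
  exact: (measurable_fun_fubini_tonelli_F (m2 := tau) _ (measurable_family_sec mk mC)).
have kN0 : \int[nu]_y prod_prob (kappa y) tau N = 0.
  have mf2 : measurable_fun setT (fun w : zseq E1 * zseq E2 => kappa w.1 [set y | N (y, w.2)]).
    pose C := [set w : (zseq E1 * zseq E2) * zseq E1 | N (w.2, w.1.2)].
    have mC : measurable C.
      rewrite -[X in measurable X]setTI.
      have mre : measurable_fun setT (fun w : (zseq E1 * zseq E2) * zseq E1 => (w.2, w.1.2)).
        apply: measurable_fun_pair; first exact: measurable_snd.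
        exact: (measurableT_comp measurable_snd measurable_fst).
      exact: mre.
    have mk (D : set (zseq E1)) : measurable D ->
        measurable_fun setT (fun x : zseq E1 * zseq E2 => kappa x.1 D).
      by move=> mD; exact: (measurableT_comp (mkappa mD) measurable_fst).
    exact: (measurable_family_sec mk mC).
  under eq_integral do rewrite prod_prob_ysec//.
  rewrite (fubini_tonelli (m1 := nu) (m2 := tau) _ mf2)// -[RHS]N0 prod_prob_ysec//.
  apply: eq_integral => z _.
  have mNz : measurable [set y | N (y, z)] by exact: measurable_ysec.
  by rewrite /= (reg_kappa.2 _ _ (@coord_sigmaT _ E1 Past) mNz) setTI.
pose bad := [set y | prod_prob (kappa y) tau N != 0].
have mbad : measurable bad.
  by rewrite /bad -[X in measurable X]setTI; exact: emeasurable_neq.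
have bad0 : nu bad = 0.
  have : ae_eq nu setT (fun y => prod_prob (kappa y) tau N) (cst 0).
    apply/ae_eq_integral_abs => //; rewrite -[RHS]kN0.
    by apply: eq_integral => p _; rewrite gee0_abs.
  move=> [V [mV V0 badV]]; apply: (subset_measure0 mbad mV) => // y /eqP by_.
  by apply: badV => /(_ I).
apply: (@ae_le_lower_integral _ _ _ mu _ _ (decode @^-1` bad)) => //.
- exact: (measurableT_comp mf (measurable_decode mdec)).
- exact: coord_sigma_decode.
- by rewrite (decode_law mg muE mdec decK).
move=> u /negP; rewrite negbK => /eqP ku0.
apply: (le_trans (fle _)); apply: ge_ereal_sup => _ [B fB <-].
have mB := coord_sigma_measurable fB.
have fdB : future n (decode @^-1` B) by exact: coord_sigma_decode.
have mdB := coord_sigma_measurable fdB.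
apply: ereal_sup_ubound; exists (decode @^-1` B) => //.
rewrite (decode_law mg muE mdec decK)//; congr `|_ - _|.
transitivity (prod_prob (kappa (decode u)) tau (code @^-1` (decode @^-1` B))).
  rewrite code_kernelE; congr (prod_prob _ _ _); apply/seteqP; split => p;
    rewrite /preimage /= /renew.
    by rewrite -[B _]/((decode @^-1` B) _) (coord_sigma_spliceC _ _ _ (future_compl_past n0 fdB)).
  by rewrite -[B (decode (splice _ _ _))]/((decode @^-1` B) _) (coord_sigma_spliceC _ _ _ (future_compl_past n0 fdB)).
transitivity (prod_prob (kappa (decode u)) tau (B `*` setT)).
  apply: (@eq_prob_mod_null _ _ _ (prod_prob (kappa (decode u)) tau) _ _ N) => //.
  - exact: measurable_code_pre.
  - exact: measurableX.
  move=> p nNp; rewrite /preimage /=.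
  have -> : decode (code p) = p.1 by apply: contrapT => /decN.
  by split => [Cp|[]].
by rewrite prod_probE// [X in (_ * X)%E]probability_setT mule1.
Qed.

Lemma beta_coef_code n : (0 < n)%N -> beta_coef mu code_kernel n = beta_coef nu kappa n.
Proof. by move=> n0; apply/eqP; rewrite eq_le beta_le// beta_ge. Qed.

End absolute_regularity.

(** * The process of distributional transforms *)

Lemma prod_prob_law (R : realType) d1 d2 d1' d2' (S1 : measurableType d1)
    (S2 : measurableType d2) (T1 : measurableType d1') (T2 : measurableType d2')
    (P1 : probability S1 R) (P2 : probability S2 R)
    (Q1 : probability T1 R) (Q2 : probability T2 R) (a : S1 -> T1) (b : S2 -> T2) :
  measurable_fun setT a -> measurable_fun setT b ->
  (forall A, measurable A -> P1 (a @^-1` A) = Q1 A) ->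
  (forall B, measurable B -> P2 (b @^-1` B) = Q2 B) ->
  forall C, measurable C ->
    prod_prob P1 P2 ((fun p => (a p.1, b p.2)) @^-1` C) = prod_prob Q1 Q2 C.
Proof.
move=> ma mb Pa Pb.
have pre d (T : measurableType d) d' (T' : measurableType d') (f : T -> T') A :
    measurable_fun setT f -> measurable A -> measurable (f @^-1` A).
  by move=> mf mA; rewrite -[X in measurable X]setTI; exact: mf.
apply: (@eq_law_pi _ _ _ _ _ (prod_prob P1 P2) (prod_prob Q1 Q2)
  (fun p => (a p.1, b p.2)) [set A `*` B | A in measurable & B in measurable]).
- apply: measurable_fun_pair.
    exact: (measurableT_comp ma measurable_fst).
  exact: (measurableT_comp mb measurable_snd).
- exact: measurable_prod_measurableType.
- move=> _ _ [A mA [B mB <-]] [A' mA' [B' mB' <-]].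
  exists (A `&` A'); first exact: measurableI.
  by exists (B `&` B'); [exact: measurableI|rewrite setXI].
move=> _ [A mA [B mB <-]].
rewrite (_ : _ @^-1` _ = (a @^-1` A) `*` (b @^-1` B))//.
by rewrite !prod_probE ?Pa ?Pb//; exact: pre.
Qed.

Section transformed_process.
Context (R : realType) (d : nat) (d_ge1 : (1 <= d)%N).
Variables (nu : probability (zseq (d.-tuple R)) R) (rho : 'I_d -> probability R R).
Hypothesis nu_shift : forall h C, measurable C ->
  nu (@shiftz (d.-tuple R) h @^-1` C) = nu C.
Hypothesis nu_marginal : forall k A, measurable A ->
  nu [set y | A (tnth (y 1) k)] = rho k A.

Local Notation E1 := (d.-tuple R).
Local Notation E3 := (d.-tuple (oitv01 R)).
Local Notation tau := (unif_noise_law R).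

(** The [d] components share one noise variable per time step: uniformity is a
    property of each component separately. *)
Definition tuple_transform (e : E1 * R) : E3 :=
  [tuple unit_transform (rho k) (tnth e.1 k, e.2) | k < d].

Definition tuple_quantile (s : E3) : E1 :=
  [tuple quantile (cdf_of (rho k)) (oitv01_val (tnth s k)) | k < d].

Lemma measurable_tuple_transform : measurable_fun setT tuple_transform.
Proof.
apply/measurable_fun_tnthP => k.
rewrite (_ : _ \o _ = (fun e : E1 * R => unit_transform (rho k) (tnth e.1 k, e.2))); last first.
  by apply/funext => e; rewrite /= tnth_mktuple.
apply: measurableT_comp; first exact: measurable_unit_transform.
apply: measurable_fun_pair; last exact: measurable_snd.
exact: (measurableT_comp (measurable_tnth k) measurable_fst).
Qed.

Lemma measurable_tuple_quantile : measurable_fun setT tuple_quantile.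
Proof.
apply/measurable_fun_tnthP => k.
rewrite (_ : _ \o _ = (fun s : E3 => quantile (cdf_of (rho k)) (oitv01_val (tnth s k)))); last first.
  by apply/funext => e; rewrite /= tnth_mktuple.
exact: (measurableT_comp (measurable_quantile (rho k)) (measurable_tnth k)).
Qed.

Let at_time (t : int) (k : 'I_d) (p : zseq E1 * zseq R) : R * R :=
  (tnth (p.1 t) k, p.2 t).

Let measurable_coord_tnth (t : int) (k : 'I_d) :
  measurable_fun setT (fun y : zseq E1 => tnth (y t) k).
Proof. exact: (measurableT_comp (measurable_tnth k) (measurable_coord t)). Qed.

Lemma law_at_time t k C : measurable C ->
  prod_prob nu tau (at_time t k @^-1` C) = prod_prob (rho k) (unif R) C.
Proof.
apply: (@prod_prob_law _ _ _ _ _ _ _ _ _ nu tau (rho k) (unif R)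
   (fun y => tnth (y t) k) (fun z => z t)).
- exact: measurable_coord_tnth.
- exact: measurable_coord.
- move=> A mA; rewrite -nu_marginal// -[RHS](nu_shift (t - 1)).
    have sh (y : zseq E1) : shiftz (t - 1) y 1 = y t by rewrite /shiftz addrC subrK.
    by congr (nu _); apply/seteqP; split => y; rewrite /preimage/= sh.
  have := measurable_coord_tnth 1 k measurableT mA.
  by rewrite setTI.
- by move=> B mB; exact: (iid_marginal (@iid_unif_noise R) t mB).
Qed.

(** [quantile_unit_transform] at each time and for each component; the union of
    these countably many null sets is null. *)
Lemma tuple_quantile_transform :
  {ae prod_prob nu tau, forall p, decode tuple_quantile (code tuple_transform p) = p.1}.
Proof.
have aetk t k : {ae prod_prob nu tau, forall p,
    quantile (cdf_of (rho k)) (oitv01_val (unit_transform (rho k) (at_time t k p))) =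
    (at_time t k p).1}.
  have [N [mN N0 qN]] := quantile_unit_transform (rho k).
  exists (at_time t k @^-1` N); split.
  - rewrite -[X in measurable X]setTI.
    have mat : measurable_fun setT (at_time t k).
      apply: measurable_fun_pair.
        exact: (measurableT_comp (measurable_coord_tnth t k) measurable_fst).
      exact: (measurableT_comp (measurable_coord t) measurable_snd).
    exact: mat.
  - by rewrite law_at_time.
  - by move=> p /= qp; apply: qN.
have [e eP] : exists e : nat -> int * 'I_d, forall x, exists n, e n = x.
  exists (fun n => odflt (0, Ordinal d_ge1) (unpickle n)) => x.
  by exists (pickle x); rewrite pickleK.
have := ae_foralln (fun n => aetk (e n).1 (e n).2).
apply: filterS => p pq; apply/funext => t; apply: eq_from_tnth => k.
have [n en] := eP (t, k); have := pq n; rewrite en /=.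
by rewrite /decode /code /tuple_quantile /tuple_transform !tnth_mktuple.
Qed.

End transformed_process.

(** * The theorem *)

Theorem theorem2p1 (R : realType) (d : nat) (d_ge1 : (1 <= d)%N)
    (dO : measure_display) (Omega : measurableType dO)
    (P : probability Omega R) (X : int -> {RV P >-> d.-tuple R})
    (statX : strictly_stationary X) :
  let pi := coord_quantile (fun k : 'I_d => cdf (marginal X 1 k : {RV P >-> R})) in
  let nu := process_law X in
  exists (dO' : measure_display) (Omega' : measurableType dO')
    (P' : probability Omega' R) (U : int -> {RV P' >-> d.-tuple (oitv01 R)}),
  let mu := process_law U in
  [/\ strictly_stationary U,
      factor_via pi mu nu,
      (forall (m : int) (k : 'I_d) (A : set R), measurable A ->
         distribution P' (marginal U m k) (@oitv01_val R @^-1` A)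
           = uniform_prob (@ltr01 R) A) &
      [/\ ergodic nu -> ergodic mu,
          weakly_mixing nu -> weakly_mixing mu &
          mixing nu -> mixing mu] /\
      [/\ forall a : nat -> R,
            strongly_mixing_rate nu a -> strongly_mixing_rate mu a,
          forall b : nat -> R,
            absolutely_regular_rate nu b -> absolutely_regular_rate mu b &
          forall f : nat -> R,
            uniformly_mixing_rate nu f -> uniformly_mixing_rate mu f]].
Proof.
pose rho k : probability R R := distribution P (marginal X 1 k : {RV P >-> R}).
pose nu0 := process_law X.
have nu_shift h C : measurable C -> nu0 (@shiftz (d.-tuple R) h @^-1` C) = nu0 C.
  by move=> mC; rewrite -[RHS](statX h).
have nu_marginal k A : measurable A -> nu0 [set y | A (tnth (y 1) k)] = rho k A by [].
pose tau := unif_noise_law R.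
have iid_tau := @iid_unif_noise R.
have mg := measurable_tuple_transform rho.
have mq := measurable_tuple_quantile rho.
have decK := tuple_quantile_transform d_ge1 nu_shift nu_marginal.
have mU n : measurable_fun setT
    (fun p : zseq (d.-tuple R) * zseq R => tuple_transform rho (p.1 n, p.2 n)).
  exact: (measurableT_comp (measurable_coord n) (measurable_code mg)).
move=> pi nu.
exists _, _, (prod_prob nu0 tau), (fun n => to_mfun (mU n)).
move=> mu.
have muE C : measurable C -> mu C = prod_prob nu0 tau (code (tuple_transform rho) @^-1` C).
  by [].
split.
- move=> h A mA.
  have sh := shift2_law iid_tau nu_shift h (measurable_code_pre mg mA).
  transitivity (prod_prob nu0 tau (code (tuple_transform rho) @^-1` A)); last exact: (muE _ mA).
  by apply: etrans sh.
- split; first exact: (measurable_decode mq).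
  by move=> A mA; exact: (decode_law mg muE mq decK).
- move=> m k A mA.
  rewrite -[RHS](_ : unif R A = _)// -(unif_unit_transform (rho k) mA).
  have mT : measurable [set p | A (oitv01_val (unit_transform (rho k) p))].
    rewrite -[X in measurable X]setTI.
    have mvt := measurableT_comp (@measurable_oitv01_val R) (measurable_unit_transform (rho k)).
    exact: mvt.
  rewrite -[RHS](law_at_time nu_shift nu_marginal m k mT).
  congr (prod_prob _ _ _); apply/seteqP; split => p; rewrite /preimage/= /marginal/=.
    by rewrite tnth_mktuple.
  by rewrite tnth_mktuple.
split; split.
- exact: (ergodic_code iid_tau mg nu_shift muE).
- exact: (weakly_mixing_code iid_tau mg nu_shift muE).
- exact: (mixing_code iid_tau mg nu_shift muE).
- move=> a [alphaE a0]; split => // n n0.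
  by rewrite (alpha_coef_code iid_tau mg muE mq decK n0) alphaE.
- move=> b [[kappa reg betaE] b0]; split => //.
  exists (code_kernel tau (tuple_quantile rho) kappa mg).
    exact: (regular_code_kernel iid_tau mg muE mq decK reg).
  by move=> n n0; rewrite (beta_coef_code mg muE mq decK reg n0) betaE.
- move=> f [phiE f0]; split => // n n0.
  by rewrite (phi_coef_code iid_tau mg muE mq decK n0 (phiE n n0)).
Qed.
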